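(* Let $\Bbbk$ be an algebraically closed field with $\operatorname{char}(\Bbbk)\neq2$. Then the quadratic $\Bbbk$-algebra on generators $x_1,x_2,x_3$ with defining relations $$x_1x_2=x_2x_1+x_1^2,\qquad x_3x_1=x_1x_3+x_1^2+3x_2^2,\qquad x_3x_2=x_2x_3-3x_2^2-2x_1x_3-2x_1x_2$$ is an Ore extension of a regular graded skew Clifford algebra.
   Context: Regular algebras. A graded $\Bbbk$-algebra $A=\bigoplus_{n\ge 0}A_n$ with $A_0=\Bbbk$, generated by the finite-dimensional space $A_1$, is regular (in the sense of Artin–Schelter) of global dimension $d$ if it has finite global dimension $d$, has polynomial growth, and is Gorenstein, i.e. $\operatorname{Ext}^i_A(\Bbbk,A)=0$ for $i\ne d$ and $\operatorname{Ext}^d_A(\Bbbk,A)\cong\Bbbk$ up to a degree shift. It is quadratic if its defining relations are spanned by a subspace of $A_1\otimes_\Bbbk A_1$. Ore extensions. For a graded algebra $R$, a graded automorphism $\phi$ of $R$, and a left $\phi$-derivation $\delta$ of $R$ (linear, raising degree by one, $\delta(ab)=\phi(a)\delta(b)+\delta(a)b$), the Ore extension $R[z;\phi,\delta]$ is generated by $R$ and a degree-one element $z$ with $zr=\phi(r)z+\delta(r)$ for $r\in R$, and is free as a left $R$-module on the powers of $z$. Graded skew Clifford algebras ($\operatorname{char}(\Bbbk)\ne2$). Let $\mu=(\mu_{ij})\in M(n,\Bbbk)$ with $\mu_{ij}\in\Bbbk^\times$, $\mu_{ij}\mu_{ji}=1$ for $i\neq j$, $\mu_{ii}=1$. A matrix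 $M$ is $\mu$-symmetric if $M_{ij}=\mu_{ij}M_{ji}$ for all $i,j$. Given $\mu$-symmetric matrices $M_1,\dots,M_n$, an associated graded skew Clifford algebra is a graded $\Bbbk$-algebra on degree-one generators $x_1,\dots,x_n$ and degree-two generators $y_1,\dots,y_n$ with defining relations given by: (a) $x_ix_j+\mu_{ij}x_jx_i=\sum_{k=1}^n (M_k)_{ij}y_k$ for all $i,j$; and (b) the existence of a normalizing sequence $\{r_1,\dots,r_n\}$ of homogeneous degree-two elements spanning $\Bbbk y_1+\cdots+\Bbbk y_n$ (normalizing: the image of $r_{k+1}$ is a normal element in the quotient by $\langle r_1,\dots,r_k\rangle$ for each $k\geq 0$). A regular graded skew Clifford algebra is a graded skew Clifford algebra that is quadratic and regular. *)

(* Defs.v *)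
From HB Require Import structures.
From mathcomp Require Import all_boot all_order all_algebra.
From mathcomp Require Import finmap monalg.

Set Implicit Arguments.
Unset Strict Implicit.
Unset Printing Implicit Defensive.

Import GRing.Theory.
Local Open Scope ring_scope.

Notation free_alg K I := {malg K[{fmonom I}]}.

Definition fgen (K : fieldType) (I : choiceType) (i : I) : free_alg K I :=
  << fmu i >>.

Definition feval (K : fieldType) (I : choiceType) (A : algType K) (x : I -> A)
    (f : free_alg K I) : A :=
  mmap (in_alg A) (fun m : {fmonom I} => \prod_(i <- (m : seq I)) x i) f.

(* [f] is homogeneous of degree [n] when the generator [i] has degree [wt i];
   0 is homogeneous of every degree *)
Definition fhomog (K : fieldType) (I : choiceType) (wt : I -> nat) (n : nat)
    (f : free_alg K I) : Prop :=
  forall m, m \in msupp f -> (\sum_(i <- (m : seq I)) wt i)%N = n.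

Inductive gen_ideal (R : nzRingType) (S : R -> Prop) : R -> Prop :=
| gen_ideal_in a of S a : gen_ideal S a
| gen_ideal0 : gen_ideal S 0
| gen_idealD a b of gen_ideal S a & gen_ideal S b : gen_ideal S (a + b)
| gen_idealMl c a of gen_ideal S a : gen_ideal S (c * a)
| gen_idealMr c a of gen_ideal S a : gen_ideal S (a * c).

Definition presented (K : fieldType) (I : choiceType) (A : algType K)
    (x : I -> A) (S : free_alg K I -> Prop) : Prop :=
  (forall a, exists f, feval x f = a) /\
  (forall f, feval x f = 0 <-> gen_ideal S f).

Definition is_grading (I : eqType) (V : zmodType) (G : I -> V -> Prop) : Prop :=
  [/\ forall i, G i 0,
      forall i u v, G i u -> G i v -> G i (u - v),
      forall v, exists (s : seq I) (w : I -> V),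
        (forall i, G i (w i)) /\ v = \sum_(i <- s) w i
    & forall (s : seq I) (w : I -> V), uniq s -> (forall i, G i (w i)) ->
        \sum_(i <- s) w i = 0 -> forall i, i \in s -> w i = 0].

Record graded_algebra (K : fieldType) := GradedAlgebra {
  gsort :> algType K;
  gpart : nat -> gsort -> Prop;
  gpart_grading : is_grading gpart;
  gpartZ : forall n (c : K) a, gpart n a -> gpart n (c *: a);
  gpart1 : gpart 0%N 1;
  gpartM : forall m n a b, gpart m a -> gpart n b -> gpart (m + n)%N (a * b)
}.
Arguments gpart {K} g _ _.

(* The subspace [W] has dimension at most [n] *)
Definition dim_le (K : fieldType) (V : lmodType K) (W : V -> Prop) (n : nat)
    : Prop :=
  exists b : 'I_n -> V, (forall i, W (b i)) /\
    (forall v, W v -> exists c : 'I_n -> K, v = \sum_i c i *: b i).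

Definition connected (K : fieldType) (A : graded_algebra K) : Prop :=
  forall a, gpart A 0%N a -> exists c : K, a = c%:A.

Definition generated_in_degree1 (K : fieldType) (A : graded_algebra K) : Prop :=
  forall B : A -> Prop,
    (forall a, gpart A 1%N a -> B a) -> B 1 ->
    (forall (c : K) a, B a -> B (c *: a)) ->
    (forall a b, B a -> B b -> B (a + b)) ->
    (forall a b, B a -> B b -> B (a * b)) ->
    forall a, B a.

Definition polynomial_growth (K : fieldType) (A : graded_algebra K) : Prop :=
  exists c e : nat, forall n, (0 < n)%N -> dim_le (gpart A n) (c * n ^ e)%N.

Definition projective (R : nzRingType) (P : lmodType R) : Prop :=
  forall (M N : lmodType R) (p : {linear M -> N}) (f : {linear P -> N}),
    (forall y, exists x, p x = y) ->
    exists g : {linear P -> M}, forall x, p (g x) = f x.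

Record resolution (R : nzRingType) (M : lmodType R) := Resolution {
  res_mod : nat -> lmodType R;
  res_d : forall i, {linear res_mod i.+1 -> res_mod i};
  res_aug : {linear res_mod 0%N -> M};
  res_projective : forall i, projective (res_mod i);
  res_aug_surj : forall y, exists x, res_aug x = y;
  res_exact0 : forall x, res_aug x = 0 <-> exists y, res_d 0%N y = x;
  res_exact : forall i x, res_d i x = 0 <-> exists y, res_d i.+1 y = x
}.

Definition proj_dim_le (R : nzRingType) (M : lmodType R) (d : nat) : Prop :=
  exists r : resolution M, forall i, (d < i)%N -> forall x : res_mod r i, x = 0.

Definition global_dim (R : nzRingType) (d : nat) : Prop :=
  (forall M : lmodType R, proj_dim_le M d) /\
  (forall e, (forall M : lmodType R, proj_dim_le M e) -> (d <= e)%N).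

Definition is_module_grading (K : fieldType) (A : graded_algebra K)
    (V : lmodType A) (G : int -> V -> Prop) : Prop :=
  is_grading G /\
  (forall m n (a : A) v, gpart A m a -> G n v -> G (m%:Z + n) (a *: v)).

Definition graded_map (V W : Type) (GV : int -> V -> Prop)
    (GW : int -> W -> Prop) (l : int) (f : V -> W) : Prop :=
  forall n v, GV n v -> GW (n + l) (f v).

Definition graded_resolution (K : fieldType) (A : graded_algebra K)
    (M : lmodType A) (GM : int -> M -> Prop) (r : resolution M)
    (P : forall i, int -> res_mod r i -> Prop) : Prop :=
  [/\ forall i, is_module_grading (P i),
      forall i, graded_map (P i.+1) (P i) 0 (res_d r i)
    & graded_map (P 0%N) GM 0 (res_aug r)].

Section Ext.
Variables (K : fieldType) (A : graded_algebra K).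
Variables (M : lmodType A) (N : lmodType A) (GN : int -> N -> Prop).
Variables (r : resolution M) (P : forall i, int -> res_mod r i -> Prop).

(* degree-[l] cocycles and coboundaries of the complex Hom_A(P_i, N) *)
Definition cocycle (i : nat) (l : int) (f : {linear res_mod r i -> N}) : Prop :=
  graded_map (@P i) GN l f /\ (forall y, f (res_d r i y) = 0).

Definition coboundary (i : nat) (l : int) :
    {linear res_mod r i -> N} -> Prop :=
  match i return {linear res_mod r i -> N} -> Prop with
  | 0%N => fun f => forall x, f x = 0
  | j.+1 => fun f => exists g : {linear res_mod r j -> N},
      graded_map (@P j) GN l g /\ (forall y, f y = g (res_d r j y))
  end.

(* cocycles modulo coboundaries form a K-space isomorphic to [V]; the scalar
   [c] acts on Hom_A(P_i, N) through the central element [c%:A] of [A] *)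
Definition cohomology_iso (i : nat) (l : int) (V : lmodType K) : Prop :=
  exists e : {linear res_mod r i -> N} -> V,
  [/\ forall (c : K) f g h, cocycle l f -> cocycle l g -> cocycle l h ->
        (forall x, h x = c%:A *: f x + g x) -> e h = c *: e f + e g,
      forall v, exists f, cocycle l f /\ e f = v
    & forall f, cocycle l f -> (e f = 0 <-> coboundary l f)].

End Ext.

(* The degree-[l] component of the graded group Ext^i_A(M, N) is isomorphic
   to [V] *)
Definition Ext_iso (K : fieldType) (A : graded_algebra K)
    (M : lmodType A) (GM : int -> M -> Prop)
    (N : lmodType A) (GN : int -> N -> Prop)
    (i : nat) (l : int) (V : lmodType K) : Prop :=
  exists (r : resolution M) (P : forall i, int -> res_mod r i -> Prop),
    graded_resolution GM P /\ cohomology_iso GN P i l V.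

(* [K] as a left module over [R] through a morphism [eps : R -> K] *)
Definition trivial_module (K : fieldType) (R : nzRingType)
  (eps : {rmorphism R -> K}) : Type := K.

Section TrivialModule.
Variables (K : fieldType) (R : nzRingType) (eps : {rmorphism R -> K}).

Definition trivial_scale (a : R) (c : trivial_module eps) : trivial_module eps :=
  (eps a * c : K).

HB.instance Definition _ := GRing.Zmodule.copy (trivial_module eps) K.

Fact trivial_scaleA a b v :
  trivial_scale a (trivial_scale b v) = trivial_scale (a * b) v.
Proof. by rewrite /trivial_scale rmorphM mulrA. Qed.

Fact trivial_scale1 : left_id 1 trivial_scale.
Proof. by move=> v; rewrite /trivial_scale rmorph1 mul1r. Qed.

Fact trivial_scaleDr : right_distributive trivial_scale +%R.
Proof. by move=> a u v; rewrite /trivial_scale mulrDr. Qed.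

Fact trivial_scaleDl v : {morph trivial_scale^~ v : a b / a + b}.
Proof. by move=> a b; rewrite /trivial_scale rmorphD mulrDl. Qed.

HB.instance Definition _ := GRing.Zmodule_isLmodule.Build R (trivial_module eps)
  trivial_scaleA trivial_scale1 trivial_scaleDr trivial_scaleDl.

Definition trivial_part (n : int) (c : trivial_module eps) : Prop :=
  n = 0 \/ c = 0.

End TrivialModule.

Definition is_augmentation (K : fieldType) (A : graded_algebra K)
    (eps : {rmorphism A -> K}) : Prop :=
  (forall c : K, eps c%:A = c) /\
  (forall n a, (0 < n)%N -> gpart A n a -> eps a = 0).

Definition regular_part (K : fieldType) (A : graded_algebra K)
    (n : int) (a : A^o) : Prop :=
  match n with Posz k => gpart A k a | Negz _ => a = 0 end.

(* Ext^i_A(k, A) is 0 for i <> d, and is k concentrated in a single degree [s]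
   for i = d; the right action of the elements of positive degree on the latter
   is then necessarily zero, so that it is k(-s) also as a right A-module *)
Definition gorenstein (K : fieldType) (A : graded_algebra K) (d : nat) : Prop :=
  exists eps : {rmorphism A -> K}, is_augmentation eps /\
  exists s : int, forall (i : nat) (l : int),
    Ext_iso (@trivial_part K A eps) (@regular_part K A) i l
      'rV[K]_((i == d) && (l == s)).

Definition regular_algebra (K : fieldType) (A : graded_algebra K) (d : nat)
    : Prop :=
  [/\ connected A,
      generated_in_degree1 A /\ (exists m, dim_le (gpart A 1%N) m),
      global_dim A d,
      polynomial_growth A
    & gorenstein A d].

Definition quadratic_algebra (K : fieldType) (A : graded_algebra K) : Prop :=
  exists (m : nat) (x : 'I_m -> A) (S : free_alg K 'I_m -> Prop),
  [/\ forall i, gpart A 1%N (x i),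
      forall f, S f -> fhomog (fun=> 1%N) 2%N f
    & presented x S].

Definition skew_parameters (K : fieldType) (n : nat) (mu : 'M[K]_n) : Prop :=
  [/\ forall i j, mu i j != 0,
      forall i j, i != j -> mu i j * mu j i = 1
    & forall i, mu i i = 1].

Definition mu_symmetric (K : fieldType) (n : nat) (mu M : 'M[K]_n) : Prop :=
  forall i j, M i j = mu i j * M j i.

Definition normal_mod (R : nzRingType) (J : R -> Prop) (b : R) : Prop :=
  forall a, (exists a', J (b * a - a' * b)) /\ (exists a', J (a * b - b * a')).

Definition ideal_before (R : nzRingType) (n : nat) (r : 'I_n -> R) (k : 'I_n)
    : R -> Prop :=
  gen_ideal (fun a => exists2 j : 'I_n, (j < k)%N & a = r j).

Definition normalizing_sequence (R : nzRingType) (n : nat) (r : 'I_n -> R)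
    : Prop :=
  forall k, normal_mod (ideal_before r k) (r k).

Section SkewClifford.
Variables (K : fieldType) (n : nat).

(* [inl i] is the generator x_i and [inr i] is the generator y_i *)
Definition clifford_wt (g : 'I_n + 'I_n) : nat :=
  match g with inl _ => 1%N | inr _ => 2%N end.

Definition clifford_gen (A : Type) (x y : 'I_n -> A) (g : 'I_n + 'I_n) : A :=
  match g with inl i => x i | inr i => y i end.

Let X (i : 'I_n) : free_alg K ('I_n + 'I_n)%type := fgen K (inl i).
Let Y (i : 'I_n) : free_alg K ('I_n + 'I_n)%type := fgen K (inr i).

Definition clifford_rel (mu : 'M[K]_n) (M : 'I_n -> 'M[K]_n) (i j : 'I_n) :
    free_alg K ('I_n + 'I_n)%type :=
  X i * X j + mu i j *: (X j * X i) - \sum_k M k i j *: Y k.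

Definition clifford_elt (P : 'M[K]_n) (k : 'I_n) :
    free_alg K ('I_n + 'I_n)%type :=
  \sum_j P k j *: Y j.

(* The relations of degree three (for g an x_i) or four (for g a y_i) that
   express the normality of r_k modulo r_1, ..., r_(k-1):
   r_k g = g' r_k + ... or g r_k = r_k g' + ... *)
Definition normality_rel (r : 'I_n -> free_alg K ('I_n + 'I_n)%type)
    (w : free_alg K ('I_n + 'I_n)%type) : Prop :=
  exists (k : 'I_n) (g : 'I_n + 'I_n) (g' : free_alg K ('I_n + 'I_n)%type),
    fhomog clifford_wt (clifford_wt g + 2)%N w /\
    (ideal_before r k (w - (r k * fgen K g - g' * r k)) \/
     ideal_before r k (w - (fgen K g * r k - r k * g'))).

(* [A] is a graded skew Clifford algebra associated to [mu] and [M]: besides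
   [clifford_rel], its defining relations are normality relations [W] for the
   elements r_k = \sum_j P k j y_j, whose images form a normalizing sequence of [A]
   spanning the span of the y_j *)
Definition skew_clifford_for (mu : 'M[K]_n) (M : 'I_n -> 'M[K]_n)
    (A : graded_algebra K) : Prop :=
  exists (x y : 'I_n -> A) (P : 'M[K]_n)
         (W : free_alg K ('I_n + 'I_n)%type -> Prop),
  let ev := feval (clifford_gen x y) in
  let r := clifford_elt P in
  [/\ (forall i, gpart A 1%N (x i)) /\ (forall i, gpart A 2%N (y i)),
      forall w, W w -> normality_rel r w,
      presented (clifford_gen x y)
        (fun f => (exists i j, f = clifford_rel mu M i j) \/ W f),
      forall j, exists c : 'I_n -> K, y j = \sum_k c k *: ev (r k)
    & normalizing_sequence (fun k => ev (r k))].

End SkewClifford.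

Definition graded_skew_clifford (K : fieldType) (A : graded_algebra K) : Prop :=
  exists (n : nat) (mu : 'M[K]_n) (M : 'I_n -> 'M[K]_n),
  [/\ skew_parameters mu, forall k, mu_symmetric mu (M k)
    & skew_clifford_for mu M A].

Definition regular_graded_skew_clifford (K : fieldType) (A : graded_algebra K)
    : Prop :=
  [/\ graded_skew_clifford A, quadratic_algebra A
    & exists d, regular_algebra A d].

Definition graded_automorphism (K : fieldType) (R : graded_algebra K)
    (phi : {lrmorphism R -> R}) : Prop :=
  bijective phi /\ (forall n a, gpart R n (phi a) <-> gpart R n a).

Definition graded_derivation (K : fieldType) (R : graded_algebra K)
    (phi : R -> R) (delta : {linear R -> R}) : Prop :=
  (forall a b, delta (a * b) = phi a * delta b + delta a * b) /\
  (forall n a, gpart R n a -> gpart R n.+1 (delta a)).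

(* [A] is isomorphic, as a graded algebra, to R[z; phi, delta]; evaluation of
   a polynomial puts the coefficients on the left of the powers of [z] *)
Definition is_Ore_extension (K : fieldType) (R : graded_algebra K)
    (phi : R -> R) (delta : R -> R) (A : graded_algebra K) : Prop :=
  exists (iota : {lrmorphism R -> A}) (z : A),
  [/\ injective iota,
      forall n a, gpart R n a -> gpart A n (iota a),
      gpart A 1%N z,
      forall a, z * iota a = iota (phi a) * z + iota (delta a)
    & forall a, exists! p : {poly R}, a = (map_poly iota p).[z]].

Definition Ore_extension_of (K : fieldType) (R A : graded_algebra K) : Prop :=
  exists (phi : {lrmorphism R -> R}) (delta : {linear R -> R}),
  [/\ graded_automorphism phi, graded_derivation phi delta
    & is_Ore_extension phi delta A].

(* Main.v *)
(* The subalgebra generated by x_1 and x_2 is the Jordan plane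
   R = k<x, y>/(xy - yx - x^2), and A is the Ore extension R[x_3; phi, delta] with
   phi(x) = x, phi(y) = y - 2x, delta(x) = x^2 + 3y^2, delta(y) = -3y^2 - 2xy.
   R is a graded skew Clifford algebra with mu_12 = -1, y_1 = x^2 and y_2 = y^2:
   x^2 is normal, and R is commutative modulo x^2.  For regularity, every R-module
   M has a Koszul resolution
     0 -> R (x) M -> R (x) (M + M) -> R (x) M -> M -> 0    (tensors over k)
   by induced modules, which are projective since k-linear surjections split; it
   bounds the global dimension by 2, and for M = k it also computes Ext(k, R). *)

Require Import Defs.
From HB Require Import structures.
From mathcomp Require Import all_boot all_order all_algebra.
From mathcomp Require Import finmap monalg.
From mathcomp Require Import ring.
From mathcomp Require boolp classical_sets.

Set Implicit Arguments.
Unset Strict Implicit.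
Unset Printing Implicit Defensive.

Import GRing.Theory.
Local Open Scope ring_scope.

(** * Ore extensions *)

(** An algebra given by generators and relations does not show that monomials are independent, so
    independence is imported from concrete models. R is itself built as an (opposite) Ore extension
    on polynomials, which makes the y^j x^i a basis; A is compared with a concrete Ore extension on
    [{poly R}] that satisfies the relations of A. The maps phi and delta come from moving x_3 to the
    right: the third relation reads x_3 x_2 = (x_2 - 2 x_1) x_3 - 3 x_2^2 - 2 x_1 x_2. Global
    dimension quantifies over all modules, so the Koszul resolution is built with coefficients in an
    arbitrary M. For a in R, let rho(a) be right multiplication on R and lambda(a) the action on M;
    the differentials use rho(a) - lambda(a). For a = x, y these operators do not commute: their
    commutator is rho(x)^2 - lambda(x)^2, which is divisible by rho(x) - lambda(x). The quotient
    rho(x) + lambda(x) is the correction term in the second differential. The characteristic enters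
    through the Clifford relations 2 x_i^2 = 2 y_i, which have to be halved. *)

Definition twisted_derivation (S : nzRingType) (phi delta : S -> S) : Prop :=
  forall a b, delta (a * b) = phi a * delta b + delta a * b.

Definition ore (S : nzRingType) (phi delta : S -> S)
  of twisted_derivation phi delta : Type := {poly S}.

Section Ore.
Variables (K : fieldType) (S : algType K).
Variables (phi : {lrmorphism S -> S}) (delta : {linear S -> S}).
Hypothesis Hd : twisted_derivation phi delta.

Local Notation T := (ore Hd).

HB.instance Definition _ := GRing.Zmodule.copy T {poly S}.

(** Left multiplication by the variable z, from z a z^i = phi(a) z^(i+1) + delta(a) z^i. The twisted
    product below is then the sum of the p_i z^i q. *)
Definition ore_shift (q : {poly S}) : {poly S} :=
  map_poly phi q * 'X + map_poly delta q.

Fact ore_shift_is_additive : additive ore_shift.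
Proof. by move=> p q; rewrite /ore_shift !raddfB /= mulrBl opprD addrACA. Qed.

HB.instance Definition _ :=
  GRing.isAdditive.Build {poly S} {poly S} ore_shift ore_shift_is_additive.

Lemma coef_ore_shift q i :
  (ore_shift q)`_i = (if i == 0%N then 0 else phi q`_i.-1) + delta q`_i.
Proof. by rewrite coefD coefMX !coef_map_id0 ?raddf0. Qed.

Lemma ore_shiftZ a q : ore_shift (a *: q) = phi a *: ore_shift q + delta a *: q.
Proof.
apply/polyP => i; rewrite coef_ore_shift [RHS]coefD !coefZ coef_ore_shift Hd mulrDr addrA.
by case: i => [|i] /=; rewrite ?mulr0 ?coefZ ?rmorphM.
Qed.

Definition ore_mul (p q : {poly S}) : {poly S} :=
  \sum_(i < size p) p`_i *: iter i ore_shift q.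

Implicit Types p q : {poly S}.

Lemma ore_mulEw n p q : (size p <= n)%N ->
  ore_mul p q = \sum_(i < n) p`_i *: iter i ore_shift q.
Proof.
move=> le_pn; rewrite /ore_mul (big_ord_widen _ (fun i => p`_i *: iter i ore_shift q) le_pn).
rewrite big_mkcond; apply: eq_bigr => i _; case: ltnP => // le_pi.
by rewrite nth_default ?scale0r.
Qed.

Lemma ore_mulDl p p' q : ore_mul (p + p') q = ore_mul p q + ore_mul p' q.
Proof.
pose n := maxn (size p) (size p').
rewrite !(@ore_mulEw n) ?leq_maxl ?leq_maxr ?size_polyD // -big_split.
by apply: eq_bigr => i _; rewrite coefD scalerDl.
Qed.

Lemma ore_mulDr p q q' : ore_mul p (q + q') = ore_mul p q + ore_mul p q'.
Proof.
rewrite -big_split; apply: eq_bigr => i _; rewrite -[RHS]scalerDr; congr (_ *: _).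
by elim: (i : nat) => //= k ->; rewrite raddfD.
Qed.

Lemma ore_mulZl a p q : ore_mul (a *: p) q = a *: ore_mul p q.
Proof.
rewrite (@ore_mulEw (size p)) ?size_scale_leq // scaler_sumr.
by apply: eq_bigr => i _; rewrite coefZ scalerA.
Qed.

Lemma ore_mulXnl i q : ore_mul 'X^i q = iter i ore_shift q.
Proof.
rewrite /ore_mul size_polyXn big_ord_recr /= big1 => [|j _].
  by rewrite add0r coefXn eqxx scale1r.
by rewrite coefXn ltn_eqF // scale0r.
Qed.

Lemma ore_mul_suml (I : Type) (s : seq I) (f : I -> {poly S}) q :
  ore_mul (\sum_(i <- s) f i) q = \sum_(i <- s) ore_mul (f i) q.
Proof.
elim: s => [|i s IH]; last by rewrite !big_cons ore_mulDl IH.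
by rewrite !big_nil /ore_mul size_poly0 big_ord0.
Qed.

Lemma twisted_derivation1 : delta 1 = 0.
Proof.
have := Hd 1 1; rewrite rmorph1 !mulr1 mul1r -[LHS]addr0.
by move=> /addrI <-.
Qed.

Lemma ore_shiftXn i : ore_shift 'X^i = 'X^(i.+1).
Proof.
apply/polyP => j; rewrite coef_ore_shift !coefXn.
have -> : delta (j == i)%:R = 0.
  by case: eqP => _; rewrite ?twisted_derivation1 ?raddf0.
by case: j => [|j]; rewrite addr0 ?rmorph_nat.
Qed.

(** Associativity with z on the left, (z p) q = z (p q). General associativity follows by iteration
    and left linearity, so the twisted Leibniz rule is spent here, through [ore_shiftZ]. *)
Lemma ore_mul_shift p q : ore_mul (ore_shift p) q = ore_shift (ore_mul p q).
Proof.
rewrite -[p]coefK poly_def raddf_sum /= !ore_mul_suml raddf_sum /=.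
apply: eq_bigr => i _.
by rewrite ore_shiftZ ore_mulDl !ore_mulZl ore_shiftZ ore_shiftXn !ore_mulXnl.
Qed.

Fact ore_mulA : associative ore_mul.
Proof.
move=> p q r; rewrite -[p]coefK poly_def.
rewrite !(ore_mul_suml _ (fun i : 'I_(size p) => p`_i *: 'X^i)) ore_mul_suml.
apply: eq_bigr => i _; rewrite !ore_mulZl; congr (_ *: _).
by rewrite !ore_mulXnl; elim: (i : nat) => //= k ->; rewrite ore_mul_shift.
Qed.

Fact ore_mul1l : left_id 1 ore_mul.
Proof. by move=> q; have := ore_mulXnl 0 q; rewrite expr0. Qed.

Lemma iter_ore_shift1 i : iter i ore_shift 1 = 'X^i.
Proof. by elim: i => [|i IH] /=; rewrite ?expr0 // IH ore_shiftXn. Qed.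

Fact ore_mul1r : right_id 1 ore_mul.
Proof.
move=> p; rewrite -[RHS]coefK poly_def; apply: eq_bigr => i _; congr (_ *: _).
exact: iter_ore_shift1.
Qed.

HB.instance Definition _ := GRing.Zmodule_isNzRing.Build T
  ore_mulA ore_mul1l ore_mul1r (fun p q r => ore_mulDl p q r)
  (fun p q r => ore_mulDr p q r) (oner_neq0 {poly S}).

Definition ore_scale (c : K) (p : T) : T := (c%:A *: (p : {poly S}) : {poly S}).

Fact ore_scaleA a b p : ore_scale a (ore_scale b p) = ore_scale (a * b) p.
Proof. by rewrite /ore_scale scalerA -scalerAl mul1r scalerA. Qed.

Fact ore_scale1 : left_id 1 ore_scale.
Proof. by move=> p; rewrite /ore_scale !scale1r. Qed.

Fact ore_scaleDr : right_distributive ore_scale +%R.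
Proof. by move=> a p q; rewrite /ore_scale -scalerDr. Qed.

Fact ore_scaleDl p : {morph ore_scale^~ p : a b / a + b}.
Proof. by move=> a b; rewrite /ore_scale -scalerDl -scalerDl. Qed.

HB.instance Definition _ := GRing.Zmodule_isLmodule.Build K T
  ore_scaleA ore_scale1 ore_scaleDr ore_scaleDl.

Fact ore_scaleAl (c : K) (p q : T) : c *: (p * q) = (c *: p) * q.
Proof. by rewrite [RHS]ore_mulZl. Qed.

HB.instance Definition _ := GRing.Lmodule_isLalgebra.Build K T ore_scaleAl.

Lemma twisted_derivation_in_alg (c : K) : delta c%:A = 0.
Proof. by rewrite linearZ /= twisted_derivation1 scaler0. Qed.

(** The scalars of K are central because [delta] kills them and [phi] fixes them, so that they
    commute with [ore_shift]. *)
Fact ore_scaleAr (c : K) (p q : T) : c *: (p * q) = p * (c *: q).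
Proof.
have shiftZ i (r : {poly S}) : iter i ore_shift (c%:A *: r) = c%:A *: iter i ore_shift r.
  elim: i => //= i ->.
  by rewrite ore_shiftZ twisted_derivation_in_alg scale0r addr0 linearZ /= rmorph1.
rewrite [LHS]scaler_sumr; apply: eq_bigr => i _.
rewrite shiftZ [LHS](@scalerA _ {poly S} c%:A) scalerA.
by rewrite -scalerAl -scalerAr mul1r mulr1.
Qed.

HB.instance Definition _ := GRing.Lalgebra_isAlgebra.Build K T ore_scaleAr.

Definition ore_var : T := 'X : {poly S}.
Definition ore_const (a : S) : T := (a%:P : {poly S}).

Lemma ore_const_mul (a : S) (p : T) :
  ore_const a * p = (a *: (p : {poly S}) : {poly S}) :> T.
Proof.
rewrite [LHS](@ore_mulEw 1) ?size_polyC_leq1 // big_ord1 /=.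
by rewrite coefC eqxx.
Qed.

Lemma ore_varX i : ore_var ^+ i = 'X^i :> {poly S}.
Proof.
elim: i => [|i IH]; first by rewrite !expr0.
rewrite [RHS]exprS [LHS]exprS.
by rewrite [LHS](ore_mulXnl 1) /= IH ore_shiftXn exprS.
Qed.

Lemma ore_var_mul p : ore_var * p = ore_shift p :> {poly S}.
Proof. exact: (ore_mulXnl 1). Qed.

Lemma ore_var_const a :
  ore_var * ore_const a = ore_const (phi a) * ore_var + ore_const (delta a).
Proof.
rewrite [LHS]ore_var_mul ore_const_mul /ore_shift !map_polyC /=.
by rewrite mul_polyC.
Qed.

Fact ore_const_is_linear : linear ore_const.
Proof.
move=> c a b; rewrite /ore_const polyCD; congr (_ + _).
suff -> : (c *: a)%:P = c%:A *: a%:P by [].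
by rewrite -mul_polyC -polyCM -scalerAl mul1r.
Qed.

HB.instance Definition _ :=
  GRing.isLinear.Build K S T *:%R ore_const ore_const_is_linear.

Fact ore_const_is_multiplicative : multiplicative ore_const.
Proof.
split=> // a b; rewrite ore_const_mul.
by rewrite /ore_const polyCM -mul_polyC.
Qed.

HB.instance Definition _ :=
  GRing.isMultiplicative.Build S T ore_const ore_const_is_multiplicative.

Lemma ore_expand (p : T) :
  p = \sum_(i < size (p : {poly S})) ore_const (p : {poly S})`_i * ore_var ^+ i.
Proof.
rewrite -[LHS](@coefK S) poly_def; apply: eq_bigr => i _.
by rewrite ore_const_mul ore_varX.
Qed.

End Ore.

(** * The Jordan plane *)

Section JordanPlane.
Variable K : fieldType.

Definition sqX_deriv (p : {poly K}) : {poly K} := 'X^2 * p^`().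

Fact sqX_deriv_is_linear : linear sqX_deriv.
Proof. by move=> c p q; rewrite /sqX_deriv linearP mulrDr -scalerAr. Qed.

HB.instance Definition _ :=
  GRing.isLinear.Build K {poly K} {poly K} *:%R sqX_deriv sqX_deriv_is_linear.

Fact sqX_deriv_twisted : twisted_derivation idfun sqX_deriv.
Proof. by move=> p q; rewrite /sqX_deriv derivM mulrDr mulrA addrC mulrCA mulrA. Qed.

(* The Jordan plane k<x, y>/(xy - yx - x^2) is the opposite of the Ore extension
   k[x][y; id, x^2 d/dx]; passing to the opposite ring makes right multiplication
   by x and y explicit in the basis y^j x^i *)
Definition jordan : Type := @ore {poly K} idfun sqX_deriv sqX_deriv_twisted.

HB.instance Definition _ := GRing.Zmodule.on jordan.

Let O := @ore {poly K} idfun sqX_deriv sqX_deriv_twisted.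

(* The operations are taken from an opaque lemma, like most functions on [jordan]
   below: conversion tests diverge when they unfold *)
Fact jordan_mul_sig : {m : jordan -> jordan -> jordan |
  forall a b, m a b = (b : O) * (a : O) :> O}.
Proof. by exists (fun a b => (b : O) * (a : O)). Qed.

Definition jordan_mul := sval jordan_mul_sig.

Lemma jordan_mulE a b : jordan_mul a b = (b : O) * (a : O) :> O.
Proof. exact: (svalP jordan_mul_sig). Qed.

Fact jordan_mulA : associative jordan_mul.
Proof. by move=> a b c; rewrite !jordan_mulE mulrA. Qed.
Fact jordan_mul1l : left_id (1 : O) jordan_mul.
Proof. by move=> a; rewrite jordan_mulE mulr1. Qed.
Fact jordan_mul1r : right_id (1 : O) jordan_mul.
Proof. by move=> a; rewrite jordan_mulE mul1r. Qed.
Fact jordan_mulDl : left_distributive jordan_mul +%R.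
Proof. by move=> a b c; rewrite !jordan_mulE mulrDr. Qed.
Fact jordan_mulDr : right_distributive jordan_mul +%R.
Proof. by move=> a b c; rewrite !jordan_mulE mulrDl. Qed.

HB.instance Definition _ := GRing.Zmodule_isNzRing.Build jordan
  jordan_mulA jordan_mul1l jordan_mul1r jordan_mulDl jordan_mulDr (oner_neq0 O).

Fact jordan_scale_sig : {m : K -> jordan -> jordan | forall c a, m c a = c *: (a : O) :> O}.
Proof. by exists (fun c a => c *: (a : O)). Qed.

Definition jordan_scale := sval jordan_scale_sig.

Lemma jordan_scaleE c a : jordan_scale c a = c *: (a : O) :> O.
Proof. exact: (svalP jordan_scale_sig). Qed.

Fact jordan_scaleA c d a : jordan_scale c (jordan_scale d a) = jordan_scale (c * d) a.
Proof. by rewrite !jordan_scaleE [LHS](@scalerA _ O). Qed.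
Fact jordan_scale1 : left_id 1 jordan_scale.
Proof. by move=> a; rewrite jordan_scaleE [LHS](@scale1r _ O). Qed.
Fact jordan_scaleDr : right_distributive jordan_scale +%R.
Proof. by move=> c a b; rewrite !jordan_scaleE [LHS](@scalerDr _ O). Qed.
Fact jordan_scaleDl a : {morph jordan_scale^~ a : c d / c + d}.
Proof. by move=> c d; rewrite !jordan_scaleE [LHS](@scalerDl _ O). Qed.

HB.instance Definition _ := GRing.Zmodule_isLmodule.Build K jordan
  jordan_scaleA jordan_scale1 jordan_scaleDr jordan_scaleDl.

Fact jordan_scaleAl (c : K) (a b : jordan) : c *: (a * b) = c *: a * b.
Proof.
rewrite [LHS]jordan_scaleE [RHS]jordan_mulE [a * b]jordan_mulE [c *: a]jordan_scaleE.
exact (@scalerAr _ (O : algType K) c (b : O) (a : O)).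
Qed.

HB.instance Definition _ := GRing.Lmodule_isLalgebra.Build K jordan jordan_scaleAl.

Fact jordan_scaleAr (c : K) (a b : jordan) : c *: (a * b) = a * (c *: b).
Proof.
rewrite [LHS]jordan_scaleE [RHS]jordan_mulE [a * b]jordan_mulE [c *: b]jordan_scaleE.
exact (@scalerAl _ (O : algType K) c (b : O) (a : O)).
Qed.

HB.instance Definition _ := GRing.Lalgebra_isAlgebra.Build K jordan jordan_scaleAr.

(** The pair (j, i) stands for the basis element y^j x^i: y is the outer polynomial variable and x
    the inner one. *)
Definition jcoef (r : jordan) (k : nat * nat) : K := (r : {poly {poly K}})`_k.1`_k.2.

Lemma jcoefD r s k : jcoef (r + s) k = jcoef r k + jcoef s k.
Proof. by rewrite /jcoef !coefD. Qed.

Lemma jcoefZ c r k : jcoef (c *: r) k = c * jcoef r k.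
Proof.
rewrite /jcoef; have -> : (c *: r : jordan) = (c%:A *: (r : {poly {poly K}})) by exact: jordan_scaleE.
by rewrite coefZ -scalerAl mul1r coefZ.
Qed.

(** Right multiplication in [jordan] is left multiplication in the Ore extension. On the basis y^j
    x^i y = y^(j+1) x^i + i y^j x^(i+1), so the coefficient at (j, i) receives the one at (j, i-1)
    with the factor i-1. *)
Fact jgens_sig : {p : jordan * jordan |
  (forall r j i, jcoef (r * p.1) (j, i) = if i == 0%N then 0 else jcoef r (j, i.-1)) /\
  (forall r j i, jcoef (r * p.2) (j, i) = (if j == 0%N then 0 else jcoef r (j.-1, i)) +
    (if i == 0%N then 0 else jcoef r (j, i.-1) *+ i.-1))}.
Proof.
exists (ore_const _ 'X, ore_var _); split=> r j i; rewrite /jcoef /=.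
  by rewrite [r * _]jordan_mulE ore_const_mul coefZ coefXM.
rewrite [r * _]jordan_mulE ore_var_mul coef_ore_shift coefD; congr (_ + _).
  by case: j => //= ; rewrite coef0.
rewrite coefXnM; case: i => [|[|i]] //=.
by rewrite coef_deriv subn2.
Qed.

Definition jx : jordan := (sval jgens_sig).1.
Definition jy : jordan := (sval jgens_sig).2.

Lemma jcoef_mulx r j i :
  jcoef (r * jx) (j, i) = if i == 0%N then 0 else jcoef r (j, i.-1).
Proof. exact: (svalP jgens_sig).1. Qed.

Lemma jcoef_muly r j i :
  jcoef (r * jy) (j, i) = (if j == 0%N then 0 else jcoef r (j.-1, i)) +
    (if i == 0%N then 0 else jcoef r (j, i.-1) *+ i.-1).
Proof. exact: (svalP jgens_sig).2. Qed.

Lemma jcoef1 k : jcoef 1 k = (k == (0, 0)%N)%:R.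
Proof.
case: k => j i; rewrite /jcoef /= [1 : jordan]/(1 : {poly {poly K}}) coef1.
by rewrite xpair_eqE; case: eqP; rewrite ?coef1 ?coef0.
Qed.

Lemma jcoef_inj r s : jcoef r =1 jcoef s -> r = s.
Proof.
move=> rs; apply: (polyP (r : {poly {poly K}}) s).1 => j; apply/polyP => i; exact: (rs (j, i)).
Qed.

Lemma jcoef_basis j i k : jcoef (jy ^+ j * jx ^+ i) k = (k == (j, i))%:R.
Proof.
elim: i k => [|i IH] [k l].
  rewrite expr0 mulr1; elim: j k l => [|j IH] k l; first by rewrite expr0 jcoef1.
  rewrite exprSr jcoef_muly !IH !xpair_eqE.
  case: k => [|k]; case: l => [|l]; rewrite ?addr0 ?add0r //=.
    by case: eqP => //=; case: l => [|l]; rewrite ?mul0rn.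
  by case: l => [|l]; rewrite ?andbF ?mul0rn ?addr0.
rewrite exprSr mulrA jcoef_mulx IH !xpair_eqE.
by case: l => [|l]; rewrite ?andbF.
Qed.

(** Repackages the coefficients as one finitely supported function on pairs, so that linear maps can
    be prescribed on the basis by [mmap]. *)
Fact jcoords_sig : {f : jordan -> {malg K[(nat * nat)%type]} |
  forall r k, (f r)@_k = jcoef r k}.
Proof.
exists (fun r => \sum_(j < size (r : {poly {poly K}}))
  \sum_(i < size (r : {poly {poly K}})`_j)
    << jcoef r (val j, val i) *g (val j, val i) >>) => r k.
case: k => j i; rewrite raddf_sum /=.
under eq_bigr do rewrite raddf_sum /=.
have [jr|jr] := ltnP j (size (r : {poly {poly K}})); last first.
  rewrite {2}/jcoef /= [r`_j]nth_default // coef0 big1 // => j' _.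
  rewrite big1 // => i' _; rewrite mcoeffU xpair_eqE.
  by rewrite ltn_eqF // (leq_trans (ltn_ord j')).
rewrite (bigD1 (Ordinal jr)) //= [X in _ + X]big1 ?addr0; last first.
  move=> j' jj; rewrite big1 // => i' _; rewrite mcoeffU xpair_eqE.
  by rewrite (negbTE jj : (val j' == j) = false).
have [ir|ir] := ltnP i (size r`_j); last first.
  rewrite {2}/jcoef /= [r`_j`_i]nth_default // big1 // => i' _.
  by rewrite mcoeffU xpair_eqE andbC ltn_eqF // (leq_trans (ltn_ord i')).
rewrite (bigD1 (Ordinal ir)) //= mcoeffUU big1 ?addr0 // => i' ii.
by rewrite mcoeffU xpair_eqE (negbTE ii : (val i' == i) = false) andbF.
Qed.

Definition jcoords := sval jcoords_sig.

Lemma mcoeff_jcoords r k : (jcoords r)@_k = jcoef r k.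
Proof. exact: (svalP jcoords_sig). Qed.

Fact jcoords_is_additive : additive jcoords.
Proof.
move=> r s; apply/malgP => k; rewrite mcoeffB !mcoeff_jcoords.
by rewrite jcoefD -scaleN1r jcoefZ mulN1r.
Qed.

HB.instance Definition _ :=
  GRing.isAdditive.Build jordan {malg K[(nat * nat)%type]} jcoords jcoords_is_additive.

Lemma jcoordsZ c r : jcoords (c *: r) = c *: jcoords r.
Proof. by apply/malgP => k; rewrite mcoeffZ !mcoeff_jcoords jcoefZ. Qed.

Lemma jcoords_basis k : jcoords (jy ^+ k.1 * jx ^+ k.2) = << k >>.
Proof.
apply/malgP => l; rewrite mcoeff_jcoords jcoef_basis mcoeffU eq_sym.
by case: k.
Qed.

Lemma jcoordsK r :
  \sum_(k <- msupp (jcoords r)) jcoef r k *: (jy ^+ k.1 * jx ^+ k.2) = r.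
Proof.
apply: jcoef_inj => k; rewrite -!mcoeff_jcoords; apply/malgP: k.
rewrite [RHS](monalgE (jcoords r)) (raddf_sum jcoords).
apply: eq_bigr => l _; rewrite /= jcoordsZ jcoords_basis mcoeff_jcoords.
by apply/malgP => m; rewrite mcoeffZ !mcoeffU mulr_natr.
Qed.

Lemma jordan_lin_ind (P : jordan -> Prop) :
    (forall c a, P a -> P (c *: a)) -> (forall a b, P a -> P b -> P (a + b)) ->
    (forall j i, P (jy ^+ j * jx ^+ i)) ->
  forall r, P r.
Proof.
move=> PZ PD Pb r; rewrite -(jcoordsK r).
elim: (X in \sum_(k <- X) _) => [|k s IH]; last by rewrite big_cons; apply/PD/IH/PZ.
by rewrite big_nil -(scale0r (jy ^+ 0 * jx ^+ 0)); apply: PZ.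
Qed.

Lemma jordan_ind (P : jordan -> Prop) :
    P 1 -> (forall c a, P a -> P (c *: a)) -> (forall a b, P a -> P b -> P (a + b)) ->
    (forall a, P a -> P (a * jx)) -> (forall a, P a -> P (a * jy)) ->
  forall r, P r.
Proof.
move=> P1 PZ PD Px Py; apply: jordan_lin_ind => // j i.
elim: i => [|i IH]; last by rewrite exprSr mulrA; apply: Px.
rewrite expr0 mulr1; elim: j => [|j IH]; first by rewrite expr0.
by rewrite exprSr; apply: Py.
Qed.

Lemma jordan_rel : jx * jy = jy * jx + jx ^+ 2.
Proof.
apply: jcoef_inj => -[j i]; rewrite jcoefD jcoef_muly.
have bx l : jcoef jx l = (l == (0, 1)%N)%:R.
  by rewrite -jcoef_basis expr0 expr1 mul1r.
have byx l : jcoef (jy * jx) l = (l == (1, 1)%N)%:R by rewrite -jcoef_basis !expr1.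
have bxx l : jcoef (jx ^+ 2) l = (l == (0, 2)%N)%:R.
  by rewrite -jcoef_basis expr0 mul1r.
rewrite !bx byx bxx !xpair_eqE.
by case: j => [|[|j]]; case: i => [|[|[|i]]]; rewrite ?addr0 ?add0r ?mul0rn.
Qed.

(** * Universal property of the Jordan plane *)

Section Evaluation.
Variables (C : nzRingType) (kappa : {rmorphism K -> C}) (u v : C).

(** Scalars act through a ring morphism [kappa], so that the target can be a matrix ring over the
    Jordan plane or a free algebra. The map exists for all u and v, which also yields the linear
    section [jsec]; the relation between u and v is what makes it multiplicative. *)
Fact jev_sig : {f : {additive jordan -> C} |
  (forall c r, f (c *: r) = kappa c * f r) /\
  (forall j i, f (jy ^+ j * jx ^+ i) = v ^+ j * u ^+ i)}.
Proof.
pose ev (r : jordan) : C := mmap kappa (fun k => v ^+ k.1 * u ^+ k.2) (jcoords r).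
have ev_add : additive ev by move=> r s; rewrite /ev !raddfB.
pose add := GRing.isAdditive.Build jordan C ev ev_add.
pose f : {additive jordan -> C} := HB.pack ev add.
exists f; split=> [c r|j i] /=; rewrite /ev.
  rewrite jcoordsZ (mmapEw (msuppZ_le _ _)) mmapE mulr_sumr.
  by apply: eq_bigr => k _; rewrite /= mcoeffZ rmorphM -mulrA.
by rewrite (jcoords_basis (j, i)) mmapU /= rmorph1 mul1r.
Qed.

Definition jev : {additive jordan -> C} := sval jev_sig.

Lemma jevZ c r : jev (c *: r) = kappa c * jev r.
Proof. exact: (svalP jev_sig).1. Qed.

Lemma jev_basis j i : jev (jy ^+ j * jx ^+ i) = v ^+ j * u ^+ i.
Proof. exact: (svalP jev_sig).2. Qed.

Hypothesis uv_rel : u * v = v * u + u ^+ 2.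

Lemma pow_rel_comm i : u ^+ i * v = v * u ^+ i + u ^+ i.+1 *+ i.
Proof.
elim: i => [|i IH]; first by rewrite !expr0 mul1r mulr1 addr0.
rewrite exprS -mulrA IH mulrDr mulrA uv_rel mulrDl -mulrA -exprS -addrA.
by congr (_ + _); rewrite -exprD add2n mulrnAr -exprS mulrS.
Qed.

End Evaluation.

Lemma pow_rel i : jx ^+ i * jy = jy * jx ^+ i + jx ^+ i.+1 *+ i.
Proof. exact/pow_rel_comm/jordan_rel. Qed.

Section EvaluationMorphism.
Variables (C : nzRingType) (kappa : {rmorphism K -> C}) (u v : C).
Hypotheses (kappa_central : forall c a, GRing.comm (kappa c) a)
  (uv_rel : u * v = v * u + u ^+ 2).

Local Notation ev := (jev kappa u v).

Lemma jev_mulx r : ev (r * jx) = ev r * u.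
Proof.
elim/jordan_lin_ind: r => [c a IH|a b IHa IHb|j i].
- by rewrite -scalerAl !jevZ IH mulrA.
- by rewrite mulrDl !raddfD /= IHa IHb mulrDl.
by rewrite -mulrA -exprSr !jev_basis exprSr mulrA.
Qed.

Lemma jev_muly r : ev (r * jy) = ev r * v.
Proof.
elim/jordan_lin_ind: r => [c a IH|a b IHa IHb|j i].
- by rewrite -scalerAl !jevZ IH mulrA.
- by rewrite mulrDl !raddfD /= IHa IHb mulrDl.
rewrite -mulrA pow_rel mulrDr mulrA -exprSr mulrnAr raddfD raddfMn /=.
by rewrite !jev_basis -mulrA (pow_rel_comm uv_rel) mulrDr mulrnAr mulrA -exprSr.
Qed.

Fact jev_is_multiplicative : multiplicative (jev kappa u v).
Proof.
split; last first.
  by have := jev_basis kappa u v 0 0; rewrite !expr0 !mulr1.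
move=> r s; elim/jordan_ind: s r => [|c a IH|a b IHa IHb|a IH|a IH] r.
- rewrite mulr1 [X in _ * X](_ : _ = 1) ?mulr1 //.
  by have := jev_basis kappa u v 0 0; rewrite !expr0 !mulr1.
- by rewrite -scalerAr !jevZ IH !mulrA kappa_central.
- by rewrite mulrDr !raddfD /= IHa IHb mulrDr.
- by rewrite mulrA !jev_mulx IH mulrA.
by rewrite mulrA !jev_muly IH mulrA.
Qed.

Lemma jev_x : ev jx = u.
Proof. by have := jev_basis kappa u v 0 1; rewrite !expr0 !expr1 !mul1r. Qed.

Lemma jev_y : ev jy = v.
Proof. by have := jev_basis kappa u v 1 0; rewrite !expr0 !expr1 !mulr1. Qed.

End EvaluationMorphism.

Section Hom.
Variables (C : algType K) (u v : C).

Definition jhom_def of u * v = v * u + u ^+ 2 : jordan -> C := jev (in_alg C) u v.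

Hypothesis uv_rel : u * v = v * u + u ^+ 2.

Local Notation hom := (jhom_def uv_rel).

HB.instance Definition _ := GRing.Additive.copy hom (jev (in_alg C) u v).

Fact jhom_is_multiplicative : multiplicative hom.
Proof.
apply: jev_is_multiplicative => // c a.
by rewrite /GRing.comm /= -scalerAl -scalerAr mul1r mulr1.
Qed.

HB.instance Definition _ :=
  GRing.isMultiplicative.Build jordan C hom jhom_is_multiplicative.

Fact jhom_is_scalable : scalable hom.
Proof. by move=> c a; rewrite [LHS]jevZ /= mulr_algl. Qed.

HB.instance Definition _ :=
  GRing.isScalable.Build K jordan C *:%R hom jhom_is_scalable.

Fact jhom_sig : {f : {lrmorphism jordan -> C} | f jx = u /\ f jy = v}.
Proof. by exists hom; split; [apply: jev_x | apply: jev_y]. Qed.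

Definition jhom : {lrmorphism jordan -> C} := sval jhom_sig.

Lemma jhom_x : jhom jx = u. Proof. exact: (svalP jhom_sig).1. Qed.
Lemma jhom_y : jhom jy = v. Proof. exact: (svalP jhom_sig).2. Qed.

End Hom.

End JordanPlane.

(** * Gradings read off from coordinates *)

Section GradingByCoordinates.
Variables (J : eqType) (V W : zmodType) (I : choiceType) (wt : I -> J).
Variables (co : {additive V -> {malg W[I]}}) (g : {malg W[I]} -> V).
Hypotheses (coK : cancel co g) (gK : cancel g co).

(** Coefficients in any group and weights in any type cover both uses: R with degrees in [nat], and
    the induced modules, whose coefficients are vectors, with degrees in [int]. *)
Lemma is_grading_coords : is_grading (fun n v => forall k, (co v)@_k != 0 -> wt k = n).
Proof.
split=> [n k|n u v hu hv k|v|s w us hw sw0 i i_s].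
- by rewrite raddf0 mcoeff0 eqxx.
- rewrite raddfB mcoeffB; have [e|/hu//] := eqVneq (co u)@_k 0.
  by rewrite e sub0r oppr_eq0; apply: hv.
- pose p n : {malg W[I]} :=
    [malg k in msupp (co v) => if wt k == n then (co v)@_k else 0].
  (* Several basis elements share a weight, and each homogeneous component must be summed once. *)
  exists (undup [seq wt k | k <- msupp (co v)]), (fun n => g (p n)); split.
    move=> n k; rewrite gK mcoeffE; case: ifP => _; last by rewrite eqxx.
    by case: (wt k =P n) => // _; rewrite eqxx.
  apply: (can_inj coK); rewrite raddf_sum; apply/malgP => k; rewrite raddf_sum /=.
  under eq_bigr do rewrite gK mcoeffE.
  have [k_v|k_v] := msuppP; last by rewrite big1.
  rewrite (bigD1_seq (wt k)) ?undup_uniq ?mem_undup ?map_f //= eqxx.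
  by rewrite big1 ?addr0 // => n; rewrite eq_sym => /negbTE ->.
apply: (can_inj coK); rewrite raddf0; apply/malgP => k; rewrite mcoeff0.
apply/eqP/negP => /negP nz; case/negP: (nz); apply/eqP.
have wk : wt k = i by apply: hw nz.
have := congr1 (fun u => (co u)@_k) sw0; rewrite /= raddf0 mcoeff0 raddf_sum raddf_sum /=.
rewrite (bigD1_seq i) //= [X in _ + X]big1 ?addr0 // => j ji.
apply/eqP/negP => /negP /hw wkj; case/negP: ji; by rewrite -wkj wk.
Qed.

End GradingByCoordinates.

(** * Automorphisms, normality of x, and grading of the Jordan plane *)

Section JordanAlgebra.
Variable K : fieldType.
Local Notation R := (jordan K).
Local Notation x := (jx K).
Local Notation y := (jy K).

Lemma jordan_hom_ext (C : algType K) (f g : {lrmorphism R -> C}) :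
  f x = g x -> f y = g y -> f =1 g.
Proof.
move=> fx fy; elim/jordan_ind => [|c a IH|a b IHa IHb|a IH|a IH].
- by rewrite !rmorph1.
- by rewrite !linearZ /= IH.
- by rewrite !raddfD /= IHa IHb.
- by rewrite !rmorphM /= IH fx.
by rewrite !rmorphM /= IH fy.
Qed.

Lemma jordan_bracket : x * y - y * x = x * x.
Proof. by rewrite jordan_rel addrAC addrN add0r expr2. Qed.

Fact jshift_rel (t : K) : x * (y + t *: x) = (y + t *: x) * x + x ^+ 2.
Proof. by rewrite mulrDr mulrDl jordan_rel -scalerAr -scalerAl addrAC. Qed.

(** A one-parameter group of automorphisms fixing x and sending y to y + t x. It gives the twist of
    the Ore extension (t = -2) and the automorphisms attached to the normal elements x (t = 1) and
    x^2 (t = 2). *)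
Definition jshift t : {lrmorphism R -> R} := jhom (jshift_rel t).

Lemma jshift_x t : jshift t x = x. Proof. exact: jhom_x. Qed.
Lemma jshift_y t : jshift t y = y + t *: x. Proof. exact: jhom_y. Qed.

Lemma jshiftD s t r : jshift s (jshift t r) = jshift (s + t) r.
Proof.
pose f : {lrmorphism R -> R} := jshift s \o jshift t.
apply: (@jordan_hom_ext _ f) => /=; rewrite ?jshift_x ?jshift_y //.
by rewrite linearD linearZ /= jshift_x jshift_y -addrA scalerDl.
Qed.

Lemma jshift0 r : jshift 0 r = r.
Proof.
apply: (@jordan_hom_ext _ (jshift 0) idfun) => /=; rewrite ?jshift_x ?jshift_y //.
by rewrite scale0r addr0.
Qed.

Lemma jshiftK t : cancel (jshift t) (jshift (- t)).
Proof. by move=> r; rewrite jshiftD addNr jshift0. Qed.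

Lemma jshiftNK t : cancel (jshift (- t)) (jshift t).
Proof. by move=> r; rewrite jshiftD addrN jshift0. Qed.

(** The defining relation reads x y = (y + x) x. *)
Lemma jx_normal r : x * r = jshift 1 r * x.
Proof.
elim/jordan_ind: r => [|c a IH|a b IHa IHb|a IH|a IH].
- by rewrite rmorph1 mulr1 mul1r.
- by rewrite linearZ -scalerAr -scalerAl IH.
- by rewrite linearD mulrDr mulrDl IHa IHb.
- by rewrite rmorphM /= jshift_x mulrA IH.
rewrite rmorphM /= jshift_y mulrA IH -!mulrA jordan_rel scale1r.
by rewrite mulrDl expr2.
Qed.

Lemma jcoef_mulyl r j i :
  jcoef (y * r) (j, i) = if j == 0%N then 0 else jcoef r (j.-1, i).
Proof.
elim/jordan_lin_ind: r => [c a IH|a b IHa IHb|m l].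
- by rewrite -scalerAr !jcoefZ IH; case: ifP; rewrite ?mulr0.
- by rewrite mulrDr !jcoefD IHa IHb; case: ifP; rewrite ?addr0.
rewrite mulrA -exprS !jcoef_basis !xpair_eqE; case: j => [|j] //.
Qed.

Lemma jordan_mulIx (r s : R) : r * x = s * x -> r = s.
Proof.
move=> rs; apply: jcoef_inj => -[j i].
by have := congr1 (fun a => jcoef a (j, i.+1)) rs; rewrite !jcoef_mulx.
Qed.

Lemma jordan_mulxI (r s : R) : x * r = x * s -> r = s.
Proof. by rewrite !jx_normal => /jordan_mulIx /(can_inj (jshiftK 1)). Qed.

(** The powers of y form a basis of R modulo R x. *)
Lemma jordan_mulx_ex (w : R) :
  (forall j, jcoef w (j, 0%N) = 0) -> exists w', w = w' * x.
Proof.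
move=> w0; exists (\sum_(k <- msupp (jcoords w)) jcoef w k *: (y ^+ k.1 * x ^+ k.2.-1)).
rewrite mulr_suml -{1}(jcoordsK w); apply: eq_bigr => -[j [|i]] _ /=.
  by rewrite w0 !scale0r mul0r.
by rewrite -scalerAl -mulrA -exprSr.
Qed.

(* Exactness in the middle of the dual of the Koszul complex *)
Lemma jordan_dual_exact (u v : R) :
  x * v = (y + x) * u -> exists r, u = x * r /\ v = y * r.
Proof.
(* The automorphism y |-> y - x turns y + x into y, and moving x to the right by [jx_normal] undoes
   it on v: the equation becomes v x = y w. *)
move=> uv; pose w := jshift (- 1) u.
have vw : v * x = y * w.
  have := congr1 (jshift (- 1)) uv; rewrite !rmorphM rmorphD /=.
  rewrite !jshift_x jshift_y scaleN1r subrK -/w => <-.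
  by rewrite jx_normal jshiftNK.
have [r wr] : exists r, w = r * x.
  (* The coefficient of y^j in w is that of y^(j+1) in y w = v x, where every basis element contains
     x. *)
  apply: jordan_mulx_ex => j.
  have := congr1 (fun a => jcoef a (j.+1, 0%N)) vw.
  by rewrite jcoef_mulx jcoef_mulyl /= => <-.
exists r; split; last by apply: jordan_mulIx; rewrite vw wr mulrA.
by rewrite jx_normal -[u](jshiftNK 1) -/w wr rmorphM /= jshift_x.
Qed.

Definition jpart (n : nat) (r : R) : Prop :=
  forall k, jcoef r k != 0 -> (k.1 + k.2)%N = n.

Fact jpart_grading : is_grading jpart.
Proof.
pose g (e : {malg K[(nat * nat)%type]}) : R :=
  \sum_(k <- msupp e) e@_k *: (y ^+ k.1 * x ^+ k.2).
have coK : cancel (@jcoords K) g.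
  move=> r; rewrite -[RHS]jcoordsK; apply: eq_bigr => k _.
  by rewrite mcoeff_jcoords.
have gK : cancel g (@jcoords K).
  move=> e; rewrite [RHS]monalgE raddf_sum; apply: eq_bigr => k _.
  rewrite /= jcoordsZ jcoords_basis.
  by apply/malgP => l; rewrite mcoeffZ !mcoeffU mulr_natr.
have [G0 GB GD GU] := is_grading_coords (fun k => (k.1 + k.2)%N) coK gK.
have E n r : jpart n r <-> forall k, (jcoords r)@_k != 0 -> (k.1 + k.2)%N = n.
  by split=> h k; [rewrite mcoeff_jcoords | rewrite -mcoeff_jcoords]; apply: h.
split=> [n|n u v /E hu /E hv|v|s w us hw].
- by apply/E/G0.
- by apply/E/GB.
- by have [s [w [hw ->]]] := GD v; exists s, w; split=> // n; exact/E/hw.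
by apply: GU us _ => n; apply/E/hw.
Qed.

Lemma jpartZ n (c : K) r : jpart n r -> jpart n (c *: r).
Proof.
move=> h k; rewrite jcoefZ mulf_eq0 negb_or => /andP[_]; exact: h.
Qed.

Lemma jpartD n r s : jpart n r -> jpart n s -> jpart n (r + s).
Proof.
move=> hr hs k; rewrite jcoefD; have [->|/hr//] := eqVneq (jcoef r k) 0.
by rewrite add0r; apply: hs.
Qed.

Lemma jpart0 n : jpart n 0.
Proof. by rewrite -(scale0r (1 : R)) => k; rewrite jcoefZ mul0r eqxx. Qed.

Lemma jpart_basis j i : jpart (j + i) (y ^+ j * x ^+ i).
Proof. by move=> k; rewrite jcoef_basis; case: (k =P (j, i)) => [->|]; rewrite ?eqxx. Qed.

Lemma jpart_ind n (P : R -> Prop) :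
    (forall c a, P a -> P (c *: a)) -> (forall a b, P a -> P b -> P (a + b)) ->
    P 0 -> (forall j i, (j + i)%N = n -> P (y ^+ j * x ^+ i)) ->
  forall r, jpart n r -> P r.
Proof.
move=> PZ PD P0 Pb r hr; rewrite -(jcoordsK r) big_seq.
apply: (big_ind P) => // k; rewrite -mcoeff_neq0 mcoeff_jcoords => /hr kn.
exact/PZ/Pb.
Qed.

Lemma jpart_mulx n r : jpart n r -> jpart n.+1 (r * x).
Proof.
move=> h [j i]; rewrite jcoef_mulx; case: i => [|i] /=; first by rewrite eqxx.
by move/h => /= <-; rewrite addnS.
Qed.

Lemma jpart_muly n r : jpart n r -> jpart n.+1 (r * y).
Proof.
move=> h [j i]; rewrite jcoef_muly.
have [->|nz] := eqVneq (if i == 0%N then 0 else jcoef r (j, i.-1) *+ i.-1) 0.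
  by case: j => [|j]; rewrite addr0 ?eqxx // => /h /= <-.
move: nz; case: i => [|i] /=; first by rewrite eqxx.
have [->|/h /= <-] := eqVneq (jcoef r (j, i)) 0; first by rewrite mul0rn eqxx.
by move=> _ _; rewrite addnS.
Qed.

Lemma jpart1 : jpart 0 1.
Proof. by have := @jpart_basis 0 0; rewrite !expr0 mulr1. Qed.

Lemma jpartx : jpart 1 x.
Proof. by rewrite -[x]mul1r; apply/jpart_mulx/jpart1. Qed.

Lemma jparty : jpart 1 y.
Proof. by rewrite -[y]mul1r; apply/jpart_muly/jpart1. Qed.

Lemma jpartM m n r s : jpart m r -> jpart n s -> jpart (m + n) (r * s).
Proof.
move=> hr; move: s; apply: jpart_ind => [c a|a b ha hb||j i <-].
- by rewrite -scalerAr; apply: jpartZ.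
- by rewrite mulrDr; apply: jpartD.
- by rewrite mulr0; apply: jpart0.
elim: i => [|i IH]; last by rewrite exprSr !mulrA !addnS; apply/jpart_mulx; rewrite -mulrA.
rewrite expr0 mulr1 addn0; elim: j => [|j IH]; first by rewrite expr0 mulr1 addn0.
by rewrite exprSr mulrA addnS; apply: jpart_muly.
Qed.

Definition jordan_graded : graded_algebra K :=
  GradedAlgebra jpart_grading jpartZ jpart1 jpartM.

Lemma jshift_part t n r : jpart n r -> jpart n (jshift t r).
Proof.
move: r; apply: jpart_ind => [c a|a b ha hb||j i <-].
- by rewrite linearZ; apply: jpartZ.
- by rewrite linearD; apply: jpartD.
- by rewrite raddf0; apply: jpart0.
rewrite rmorphM !rmorphXn /= jshift_x jshift_y.
elim: i => [|i IH]; last by rewrite exprSr !mulrA addnS; apply/jpart_mulx.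
rewrite expr0 mulr1 addn0; elim: j => [|j IH]; first by rewrite expr0; apply: jpart1.
rewrite exprSr -addn1; apply: jpartM => //; apply: jpartD; first exact: jparty.
exact/jpartZ/jpartx.
Qed.

(** Decides the top Ext group: the 2-coboundaries take their values in x R + y R, which contains
    everything of positive degree. *)
Lemma jordan_split n r : jpart n.+1 r ->
  exists a b, [/\ jpart n a, jpart n b & r = x * a + y * b].
Proof.
move: r; apply: jpart_ind => [c r|r s||j i ji].
- case=> a [b [ha hb ->]]; exists (c *: a), (c *: b).
  by split; [exact: jpartZ | exact: jpartZ | rewrite -!scalerAr scalerDr].
- case=> a [b [ha hb ->]] [a' [b' [ha' hb' ->]]]; exists (a + a'), (b + b').
  by split; [exact: jpartD | exact: jpartD | rewrite !mulrDr addrACA].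
- by exists 0, 0; rewrite !mulr0 addr0; split=> //; apply: jpart0.
case: j ji => [|j] /= [ji]; last first.
  exists 0, (y ^+ j * x ^+ i); rewrite mulr0 add0r mulrA -exprS -ji.
  by split=> //; [apply: jpart0 | apply: jpart_basis].
case: i ji => // i [<-]; exists (x ^+ i), 0; rewrite mulr0 addr0 mul1r -exprS.
by split=> //; [have := @jpart_basis 0 i; rewrite mul1r | apply: jpart0].
Qed.

End JordanAlgebra.

(** * Presentations *)

Lemma malgUZ (I : choiceType) (S : nzRingType) (c : S) (k : I) :
  << c *g k >> = c *: (<< k >> : {malg S[I]}).
Proof. by apply/malgP => l; rewrite mcoeffZ !mcoeffU mulr_natr. Qed.

Section GeneratedIdeal.
Variables (R : nzRingType) (S : R -> Prop).

Lemma gen_idealN a : gen_ideal S a -> gen_ideal S (- a).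
Proof. by rewrite -mulN1r; apply: gen_idealMl. Qed.

Lemma gen_ideal_congr a b c : gen_ideal S (b - c) -> gen_ideal S (a - b) -> gen_ideal S (a - c).
Proof. by move=> bc ab; rewrite -(subrKA b); apply: gen_idealD. Qed.

Lemma gen_ideal_congrMr a b c d :
  gen_ideal S (a - b) -> gen_ideal S (b * c - d) -> gen_ideal S (a * c - d).
Proof.
move=> ab bcd; apply: gen_ideal_congr bcd _; rewrite -mulrBl.
exact: gen_idealMr.
Qed.

(** Intended for u = y_i and v = x_i: multiplying by the Clifford generator y_i reduces to
    multiplying twice by x_i. *)
Lemma gen_ideal_mul2 a b c u v :
    gen_ideal S (u - v * v) -> gen_ideal S (a * v - b) -> gen_ideal S (b * v - c) ->
  gen_ideal S (a * u - c).
Proof.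
move=> uv av bv; apply: (gen_ideal_congr (b := a * v * v)).
  exact: gen_ideal_congrMr av bv.
by rewrite -mulrA -mulrBr; apply: gen_idealMl.
Qed.

(** The rule for y^j x^i y in the Jordan plane, lifted to words modulo an ideal containing the
    Jordan relation. *)
Lemma gen_ideal_pow_comm X Y j i : gen_ideal S (X * Y - (Y * X + X ^+ 2)) ->
  gen_ideal S (Y ^+ j * X ^+ i * Y - (Y ^+ j.+1 * X ^+ i + Y ^+ j * X ^+ i.+1 *+ i)).
Proof.
move=> SXY; rewrite exprSr -!mulrA -mulrnAr -mulrDr -mulrBr; apply: gen_idealMl.
elim: i => [|i IH].
  by rewrite !expr0 mul1r mulr1 mulr0n addr0 subrr; apply: gen_ideal0.
rewrite exprS -mulrA; apply: (gen_ideal_congr _ (b := X * (Y * X ^+ i + X ^+ i.+1 *+ i))).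
  rewrite mulrDr mulrnAr -exprS (mulrSr (X ^+ _)) [X in _ - X]addrCA addrKA.
  suff -> : X * (Y * X ^+ i) - (Y * (X * X ^+ i) + X ^+ i.+2) =
    (X * Y - (Y * X + X ^+ 2)) * X ^+ i by apply: gen_idealMr.
  by rewrite mulrBl mulrDl !mulrA -exprD.
by rewrite -mulrBr; apply: gen_idealMl.
Qed.

End GeneratedIdeal.

Lemma gen_idealZ (K : pzRingType) (F : lalgType K) (S : F -> Prop) c a :
  gen_ideal S a -> gen_ideal S (c *: a).
Proof. by rewrite -mulr_algl; apply: gen_idealMl. Qed.

Section FreeAlgebra.
Variables (K : fieldType) (I : choiceType).
Local Notation F := (free_alg K I).

Lemma free_ind (P : F -> Prop) :
    P 1 -> (forall c f, P f -> P (c *: f)) -> (forall f g, P f -> P g -> P (f + g)) ->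
    (forall f i, P f -> P (f * fgen K i)) ->
  forall f, P f.
Proof.
move=> P1 PZ PD Pg f; rewrite (monalgE f).
elim: (X in \sum_(m <- X) _) => [|m s IH].
  by rewrite big_nil -(scale0r (1 : F)); apply: PZ.
rewrite big_cons; apply: PD => //.
rewrite malgUZ; apply: PZ; case: m => m; elim/last_ind: m => [|m i IHm].
  by have -> : FMonom [::] = mone :> {fmonom I} by apply/val_inj; rewrite /= fm1.
have -> : (<< FMonom (rcons m i) >> : F) = << FMonom m >> * fgen K i.
  rewrite malgM_def fgmulUU mulr1; congr << _ *g _ >>.
  by apply/val_inj; rewrite /= fmM /fmu fmE /= cats1.
exact: Pg.
Qed.

Section Eval.
Variables (A : algType K) (z : I -> A).

Definition fword (m : {fmonom I}) : A := \prod_(i <- (m : seq I)) z i.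

Fact fword_mmorphism : mmorphism fword.
Proof.
by split=> [m n|]; rewrite /fword ?fmM ?big_cat // fm1 big_nil.
Qed.

HB.instance Definition _ := monalg.isMultiplicative.Build {fmonom I} A fword fword_mmorphism.

HB.instance Definition _ :=
  GRing.Additive.copy (feval z) (mmap (in_alg A) fword).

Fact feval_is_multiplicative : multiplicative (feval z).
Proof.
apply: (@commr_mmap_is_multiplicative _ _ _ (in_alg A) fword) => g m m'.
by rewrite /GRing.comm /= -scalerAl -scalerAr mul1r mulr1.
Qed.

HB.instance Definition _ :=
  GRing.isMultiplicative.Build F A (feval z) feval_is_multiplicative.

Fact feval_is_scalable : scalable (feval z).
Proof.
by move=> c f; rewrite -mul_malgC rmorphM /= [feval z _]mmapU /= /fword fm1 big_nil
  mulr1 mulr_algl.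
Qed.

HB.instance Definition _ :=
  GRing.isScalable.Build K F A *:%R (feval z) feval_is_scalable.

Lemma feval_gen i : feval z (fgen K i) = z i.
Proof. by rewrite [LHS]mmapU /= scale1r mul1r /fmu fmE big_seq1. Qed.

Fact fhom_sig : {f : {lrmorphism F -> A} | f =1 feval z}.
Proof. by exists (feval z). Qed.

Definition fhom : {lrmorphism F -> A} := sval fhom_sig.

Lemma fevalE : feval z =1 fhom.
Proof. by move=> f; rewrite /fhom (svalP fhom_sig). Qed.

Lemma fhom_gen i : fhom (fgen K i) = z i.
Proof. by rewrite -fevalE feval_gen. Qed.

End Eval.

Lemma fhom_gen_ideal (A : algType K) (z : I -> A) (S : F -> Prop) f :
  (forall f, S f -> fhom z f = 0) -> gen_ideal S f -> fhom z f = 0.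
Proof.
move=> S0; elim=> {f} [f /S0 //||f g _ f0 _ g0|f g _ g0|f g _ g0].
- exact: raddf0.
- by rewrite raddfD /= f0 g0 addr0.
- by rewrite rmorphM /= g0 mulr0.
by rewrite rmorphM /= g0 mul0r.
Qed.

(** Here s picks a normal form for each element of A. If appending a generator to a normal form can
    be corrected modulo the ideal, induction on f shows that f is congruent to s of its value; hence
    an f of value 0 lies in the ideal. *)
Lemma presented_normal_form (A : algType K) (z : I -> A) (S : F -> Prop)
    (s : {linear A -> F}) :
    (forall a, fhom z (s a) = a) -> (forall f, S f -> fhom z f = 0) ->
    gen_ideal S (1 - s 1) ->
    (forall i a, gen_ideal S (s a * fgen K i - s (a * z i))) ->
  presented z S.
Proof.
move=> sK S0 s1 sM; split=> [a|f]; first by exists (s a); rewrite fevalE.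
rewrite fevalE; split=> [f0|]; last exact: fhom_gen_ideal.
suff : gen_ideal S (f - s (fhom z f)) by rewrite f0 raddf0 subr0.
elim/free_ind: f {f0} => [|c f IH|f g IHf IHg|f i IH].
- by rewrite rmorph1.
- by rewrite !linearZ /= -scalerDr; apply: gen_idealZ.
- by rewrite !raddfD /= addrACA; apply: gen_idealD.
rewrite rmorphM /= fhom_gen; exact: gen_ideal_congrMr IH (sM i _).
Qed.

End FreeAlgebra.

Section JordanPresentation.
Variables (K : fieldType) (I : choiceType).
Local Notation F := (free_alg K I).
Local Notation R := (jordan K).
Local Notation x := (jx K).
Local Notation y := (jy K).
Variables X Y : F.

(** The normal-form section y^j x^i |-> Y^j X^i. As X and Y are arbitrary elements of a free
    algebra, it serves the presentations on two and on four generators and, coefficient by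
    coefficient, the one of A. *)
Definition jsec : R -> F := jev (@malgC {fmonom I} K) X Y.

HB.instance Definition _ := GRing.Additive.on jsec.

Fact jsec_is_scalable : scalable jsec.
Proof. by move=> c r; rewrite /jsec jevZ /= mul_malgC. Qed.

HB.instance Definition _ :=
  GRing.isScalable.Build K R F *:%R jsec jsec_is_scalable.

Lemma jsec_basis j i : jsec (y ^+ j * x ^+ i) = Y ^+ j * X ^+ i.
Proof. exact: jev_basis. Qed.

Lemma jsec1 : jsec 1 = 1.
Proof. by have := jsec_basis 0 0; rewrite !expr0 !mulr1. Qed.

Lemma jsec_mulx r : jsec (r * x) = jsec r * X.
Proof.
elim/jordan_lin_ind: r => [c a IH|a b IHa IHb|j i].
- by rewrite -scalerAl !linearZ /= -scalerAl IH.
- by rewrite mulrDl !raddfD /= mulrDl IHa IHb.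
by rewrite -mulrA -exprSr !jsec_basis exprSr mulrA.
Qed.

Lemma jsec_muly (S : F -> Prop) r : gen_ideal S (X * Y - (Y * X + X ^+ 2)) ->
  gen_ideal S (jsec r * Y - jsec (r * y)).
Proof.
move=> SXY; elim/jordan_lin_ind: r => [c a IH|a b IHa IHb|j i].
- by rewrite -scalerAl !linearZ /= -scalerAl -scalerDr; apply: gen_idealZ.
- by rewrite mulrDl !raddfD /= mulrDl addrACA; apply: gen_idealD.
rewrite -mulrA pow_rel mulrDr mulrA -exprSr mulrnAr raddfD raddfMn /= !jsec_basis.
exact: gen_ideal_pow_comm.
Qed.

Lemma fhom_jsec (A : algType K) (z : I -> A)
    (uv : fhom z X * fhom z Y = fhom z Y * fhom z X + fhom z X ^+ 2) r :
  fhom z (jsec r) = jhom uv r.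
Proof.
elim/jordan_lin_ind: r => [c a IH|a b IHa IHb|j i].
- by rewrite !linearZ /= IH.
- by rewrite !raddfD /= IHa IHb.
by rewrite jsec_basis !rmorphM !rmorphXn /= jhom_x jhom_y.
Qed.

End JordanPresentation.

(** * The graded skew Clifford structure *)

Section JordanIsSkewClifford.
Variable K : fieldType.
Local Notation R := (jordan K).
Local Notation x := (jx K).
Local Notation y := (jy K).

Lemma fhomog_mul (I : choiceType) (wt : I -> nat) (i j : I) n :
  (wt i + wt j)%N = n -> fhomog wt n (fgen K i * fgen K j).
Proof.
move=> <- m; rewrite malgM_def fgmulUU mulr1 msuppU1 in_fset1 => /eqP ->.
by rewrite fmM big_cat /= !fmU !big_seq1.
Qed.

Lemma fhomogB (I : choiceType) (wt : I -> nat) n (f g : free_alg K I) :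
  fhomog wt n f -> fhomog wt n g -> fhomog wt n (f - g).
Proof.
move=> hf hg m m_fg; have := fsubsetP (msuppB_le f g) m m_fg.
by rewrite in_fsetU => /orP[/hf|/hg].
Qed.

Lemma rmorph_relator (A B : nzRingType) (f : {rmorphism A -> B}) u v :
  f (u * v - v * u - u * u) = f u * f v - f v * f u - f u * f u.
Proof. by rewrite !rmorphB !rmorphM. Qed.

Definition jgen (i : 'I_2) : R := if i == ord0 then x else y.

Definition jordan_relator : free_alg K 'I_2 :=
  let X := fgen K (ord0 : 'I_2) in let Y := fgen K (ord_max : 'I_2) in
  X * Y - Y * X - X * X.

Lemma jordan_quadratic : quadratic_algebra (jordan_graded K).
Proof.
exists 2%N, jgen, (eq jordan_relator); split.
- by move=> i; rewrite /= /jgen; case: eqP => _; [apply: jpartx | apply: jparty].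
- by move=> _ <-; apply: fhomogB; [apply: fhomogB|]; apply: fhomog_mul.
pose X := fgen K (ord0 : 'I_2); pose Y := fgen K (ord_max : 'I_2).
have evX : fhom jgen X = x by rewrite fhom_gen.
have evY : fhom jgen Y = y by rewrite fhom_gen.
have uv : fhom jgen X * fhom jgen Y = fhom jgen Y * fhom jgen X + fhom jgen X ^+ 2.
  by rewrite evX evY jordan_rel.
apply: (@presented_normal_form K _ R jgen _ (jsec X Y)).
- move=> r; rewrite (fhom_jsec uv).
  apply: (@jordan_hom_ext _ _ (jhom uv) idfun); first by rewrite jhom_x.
  by rewrite jhom_y.
- move=> _ <-; rewrite [LHS]rmorph_relator /= -/X -/Y evX evY.
  by rewrite jordan_bracket subrr.
- by rewrite /= jsec1 subrr; apply: gen_ideal0.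
move=> i r; rewrite /jgen; case: eqP => [->|i0].
  by rewrite /= jsec_mulx subrr; apply: gen_ideal0.
have -> : i = ord_max by apply/val_inj; case: i i0 => [[|[|]]] //= ? [] ; apply/val_inj.
apply: jsec_muly; apply: gen_ideal_in.
by rewrite /jordan_relator -/X -/Y opprD addrA.
Qed.

Definition clifford_mu : 'M[K]_2 := \matrix_(i, j) (-1) ^+ (i != j).

(* The relations 2 x^2 = 2 y_0, xy - yx = y_0 and 2 y^2 = 2 y_1 *)
Definition clifford_M (k : 'I_2) : 'M[K]_2 :=
  \matrix_(i, j) if k == ord0
    then (if i == ord0 then (if j == ord0 then 2%:R else 1)
          else (if j == ord0 then -1 else 0))
    else ((i != ord0) && (j != ord0))%:R *+ 2.

Lemma ord2P (i : 'I_2) : i = ord0 \/ i = ord_max.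
Proof. by case: i => [[|[|]]] // ?; [left | right]; apply/val_inj. Qed.

Lemma clifford_mu_skew : skew_parameters clifford_mu.
Proof.
split=> [i j|i j ij|i]; rewrite !mxE ?eqxx //; first by rewrite signr_eq0.
by rewrite (eq_sym j) ij /= expr1 mulrN1 opprK.
Qed.

Lemma clifford_M_symmetric k : mu_symmetric clifford_mu (clifford_M k).
Proof.
move=> i j; rewrite !mxE.
by case: (ord2P i) => ->; case: (ord2P j) => -> /=; case: (ord2P k) => -> /=;
  rewrite ?eqxx ?mul1r ?mulN1r ?opprK ?mul0rn ?oppr0.
Qed.

Lemma jordan_mulx2_normal (r : R) : x ^+ 2 * r = jshift 2%:R r * x ^+ 2.
Proof.
rewrite expr2 -mulrA (jx_normal r) mulrA (jx_normal (jshift 1 r)) jshiftD -mulrA.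
by [].
Qed.

Lemma jordan_commute_mod (S : R -> Prop) (a b : R) :
  gen_ideal S (x ^+ 2) -> gen_ideal S (a * b - b * a).
Proof.
move=> Sx; have xy : gen_ideal S (x * y - y * x) by rewrite jordan_rel addrC addKr.
have yx : gen_ideal S (y * x - x * y) by rewrite -opprB; apply: gen_idealN.
(* Commuting with both generators suffices. This is used for c = a, and then for c = x and c = y to
   meet its hypotheses. *)
have comm_gen c : gen_ideal S (c * x - x * c) -> gen_ideal S (c * y - y * c) ->
    forall r, gen_ideal S (c * r - r * c).
  move=> cx cy; elim/jordan_ind => [|k r IH|r s IHr IHs|r IH|r IH].
  - by rewrite mulr1 mul1r subrr; apply: gen_ideal0.
  - rewrite -scalerAr -scalerAl -scalerBr -[c * r - _]mul1r scalerAl.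
    exact: gen_idealMl.
  - by rewrite mulrDr mulrDl opprD addrACA; apply: gen_idealD.
  - rewrite mulrA; apply: (gen_ideal_congrMr (b := r * c)) => //.
    by rewrite -!mulrA -mulrBr; apply: gen_idealMl.
  rewrite mulrA; apply: (gen_ideal_congrMr (b := r * c)) => //.
  by rewrite -!mulrA -mulrBr; apply: gen_idealMl.
have xx : gen_ideal S (x * x - x * x) by rewrite subrr; apply: gen_ideal0.
have yy : gen_ideal S (y * y - y * y) by rewrite subrr; apply: gen_ideal0.
by apply: (comm_gen a); rewrite -opprB; apply: gen_idealN; apply: (comm_gen _).
Qed.

(** X and U are arbitrary so that the formula applies both to the generators of the free algebra and
    to their images in the Jordan plane. *)
Lemma clifford_relator_eval (F : lalgType K) (X U : 'I_2 -> F) (i j : 'I_2) :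
  (X i * X j + clifford_mu i j *: (X j * X i) - \sum_k clifford_M k i j *: U k =
  if i == ord0 then
    if j == ord0 then (X ord0 * X ord0 - U ord0) *+ 2
    else X ord0 * X ord_max - X ord_max * X ord0 - U ord0
  else if j == ord0 then U ord0 - (X ord0 * X ord_max - X ord_max * X ord0)
    else (X ord_max * X ord_max - U ord_max) *+ 2)%R.
Proof.
have -> : (\sum_k clifford_M k i j *: U k =
    clifford_M ord0 i j *: U ord0 + clifford_M ord_max i j *: U ord_max)%R.
  have <- : lift ord0 ord0 = ord_max :> 'I_2 by apply/val_inj.
  by rewrite big_ord_recl big_ord1.
rewrite !mxE.
case: (ord2P i) => ->; case: (ord2P j) => -> /=.
- by rewrite expr0 scale1r mul0rn scale0r addr0 scaler_nat mulrnBl -mulr2n.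
- by rewrite expr1 scaleN1r mul0rn scale0r addr0 scale1r.
- by rewrite expr1 !scaleN1r mul0rn scale0r addr0 opprK opprB addrC.
by rewrite expr0 scale1r scale0r add0r scaler_nat mulrnBl -mulr2n.
Qed.

Hypothesis char_neq2 : 2%N \notin [pchar K].

Lemma two_neq0 : 2%:R != 0 :> K.
Proof. by move: char_neq2; rewrite inE /= . Qed.

Lemma lrmorph_clifford_relator (F C : lalgType K) (f : {lrmorphism F -> C}) n
    (u v : F) (c : K) (M : 'I_n -> K) (U : 'I_n -> F) :
  f (u * v + c *: (v * u) - \sum_k M k *: U k) =
  f u * f v + c *: (f v * f u) - \sum_k M k *: f (U k).
Proof.
rewrite raddfB raddfD /= linearZ /= !rmorphM /= raddf_sum /=.
by under eq_bigr do rewrite linearZ.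
Qed.

(** The diagonal relators are twice x_i^2 - y_i and can be halved. Replacing y_0 by x^2 in the
    relator xy - yx - y_0 then yields the Jordan relation. *)
Lemma clifford_relators_ideal (F : lalgType K) (X U : 'I_2 -> F) (S : F -> Prop) :
    (forall i j, gen_ideal S (X i * X j + clifford_mu i j *: (X j * X i)
       - \sum_k clifford_M k i j *: U k)) ->
  gen_ideal S (X ord0 * X ord_max - (X ord_max * X ord0 + X ord0 ^+ 2)) /\
  (forall i, gen_ideal S (U i - X i * X i)).
Proof.
move=> SX; have halve a : gen_ideal S (a *+ 2) -> gen_ideal S a.
  by move=> /(gen_idealZ (2%:R^-1)); rewrite -scaler_nat scalerA mulVf ?two_neq0 ?scale1r.
have sq i : gen_ideal S (X i * X i - U i).
  by case: (ord2P i) => ->; apply: halve; [have := SX ord0 ord0 | have := SX ord_max ord_max];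
    rewrite clifford_relator_eval.
split=> [|i]; last by rewrite -opprB; apply: gen_idealN.
have := SX ord0 ord_max; rewrite clifford_relator_eval /= opprD addrA.
apply: (gen_ideal_congr _); rewrite -opprB; apply: gen_idealN.
exact: sq.
Qed.

Lemma jordan_skew_clifford : graded_skew_clifford (jordan_graded K).
Proof.
exists 2%N, clifford_mu, clifford_M; split.
- exact: clifford_mu_skew.
- exact: clifford_M_symmetric.
pose sq (i : 'I_2) : R := jgen i * jgen i.
(* The relations of type (a) alone already present the Jordan plane, where x^2, y^2 is a normalizing
   sequence: so r_k = y_k and the set of additional normality relations is empty. *)
exists jgen, sq, 1%:M, (fun=> False).
set z := clifford_gen jgen sq; set ev := feval z; set r := clifford_elt _.
pose G i : free_alg K ('I_2 + 'I_2)%type := fgen K i.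
have rE k : r k = G (inr k).
  rewrite /r /clifford_elt (bigD1 k) //= mxE eqxx scale1r big1 ?addr0 // => j jk.
  by rewrite mxE eq_sym (negbTE jk) scale0r.
have evr k : ev (r k) = sq k by rewrite /ev rE feval_gen.
split=> //.
- split=> i; rewrite /sq /jgen; case: eqP => _.
  + exact: jpartx.
  + exact: jparty.
  + exact: (jpartM (@jpartx K) (@jpartx K)).
  exact: (jpartM (@jparty K) (@jparty K)).
- pose X := G (inl ord0); pose Y := G (inl ord_max).
  have evX : fhom z X = x by rewrite fhom_gen.
  have evY : fhom z Y = y by rewrite fhom_gen.
  have uv : fhom z X * fhom z Y = fhom z Y * fhom z X + fhom z X ^+ 2.
    by rewrite evX evY jordan_rel.
  set S := fun f => _.
  have [SXY SU] : gen_ideal S (X * Y - (Y * X + X ^+ 2)) /\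
      (forall i, gen_ideal S (G (inr i) - G (inl i) * G (inl i))).
    apply: clifford_relators_ideal (fun i => G (inl i)) (fun i => G (inr i)) _ _.
    by move=> i j; apply: gen_ideal_in; left; exists i, j.
  apply: (@presented_normal_form K _ R z _ (jsec X Y)).
  + move=> a; rewrite (fhom_jsec uv).
    apply: (@jordan_hom_ext _ _ (jhom uv) idfun); first by rewrite jhom_x.
    by rewrite jhom_y.
  + move=> f [[i [j ->]]|//].
    have -> : fhom z (clifford_rel clifford_mu clifford_M i j) =
        jgen i * jgen j + clifford_mu i j *: (jgen j * jgen i)
        - \sum_k clifford_M k i j *: sq k.
      rewrite [LHS]lrmorph_clifford_relator !fhom_gen /=; congr (_ - _).
      by apply: eq_bigr => k _; rewrite fhom_gen.
    rewrite clifford_relator_eval /sq /jgen /= jordan_bracket !subrr.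
    by rewrite mul0rn !if_same.
  + by rewrite /= jsec1 subrr; apply: gen_ideal0.
  have secM i a : gen_ideal S (jsec X Y a * G (inl i) - jsec X Y (a * jgen i)).
    rewrite /jgen; case: (ord2P i) => -> /=; last exact: jsec_muly.
    by rewrite jsec_mulx subrr; apply: gen_ideal0.
  move=> [i|i] a; first exact: secM.
  apply: gen_ideal_mul2 (SU i) (secM i a) _.
  rewrite /sq mulrA; exact: secM.
- move=> j; exists (fun k => (k == j)%:R).
  rewrite (eq_bigr (fun k => (k == j)%:R *: sq k)) => [|k _]; last by congr (_ *: _).
  rewrite (bigD1 j) //= eqxx scale1r.
  by rewrite big1 ?addr0 // => k /negbTE ->; rewrite scale0r.
have -> : (fun k => ev (r k)) = sq by apply: boolp.funext.
move=> k a; case: (ord2P k) => -> {k}; rewrite /sq /jgen /= -!expr2.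
  split; [exists (jshift 2%:R a) | exists (jshift (- 2%:R) a)].
    by rewrite jordan_mulx2_normal subrr; apply: gen_ideal0.
  by rewrite jordan_mulx2_normal jshiftNK subrr; apply: gen_ideal0.
have Sx : ideal_before sq ord_max (x ^+ 2).
  by apply: gen_ideal_in; exists ord0; rewrite // /sq /jgen /= expr2.
by split; exists a; apply: jordan_commute_mod.
Qed.

End JordanIsSkewClifford.

(** * Derivations and growth of the Jordan plane *)

Section JordanDerivation.
Variable K : fieldType.
Local Notation R := (jordan K).
Local Notation x := (jx K).
Local Notation y := (jy K).

Definition triang (a b d : R) : 'M[R]_2 :=
  \matrix_(i, j) if i == ord0 then (if j == ord0 then a else b)
                 else (if j == ord0 then 0 else d).

Lemma matrix2_eq (A B : 'M[R]_2) :
  A ord0 ord0 = B ord0 ord0 -> A ord0 ord_max = B ord0 ord_max ->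
  A ord_max ord0 = B ord_max ord0 -> A ord_max ord_max = B ord_max ord_max -> A = B.
Proof.
move=> ? ? ? ?; apply/matrixP => i j.
by case: (ord2P i) => ->; case: (ord2P j) => ->.
Qed.

Lemma mul_matrix2 (A B : 'M[R]_2) i j :
  (A * B) i j = A i ord0 * B ord0 j + A i ord_max * B ord_max j.
Proof.
rewrite mxE big_ord_recl big_ord1.
by have -> : lift ord0 ord0 = ord_max :> 'I_2 by apply/val_inj.
Qed.

Lemma triangM a b d a' b' d' :
  triang a b d * triang a' b' d' = triang (a * a') (a * b' + b * d') (d * d').
Proof.
by apply: matrix2_eq; rewrite mul_matrix2 !mxE /= ?mulr0 ?mul0r ?addr0 ?add0r.
Qed.

Lemma triangD a b d a' b' d' :
  triang a b d + triang a' b' d' = triang (a + a') (b + b') (d + d').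
Proof. by apply: matrix2_eq; rewrite !mxE /= ?addr0. Qed.

(* A map [delta] is a [phi]-derivation iff a |-> [[phi a, delta a], [0, a]] is
   multiplicative, so it is enough to check the defining relation on the images
   of x and y *)
Lemma jordan_derivation (t : K) (dx dy : R) :
    x * dy + dx * y = (y + t *: x) * dx + dy * x + (x * dx + dx * x) ->
  exists delta : {linear R -> R},
    [/\ twisted_derivation (jshift t) delta, delta x = dx & delta y = dy].
Proof.
move=> dxy.
pose kappa : {rmorphism K -> 'M[R]_2} := scalar_mx \o in_alg R.
have kappaE c A i j : (kappa c * A) i j = c *: (A i j).
  by rewrite [kappa c * A]mul_scalar_mx mxE /= mulr_algl.
have kappaEr c A i j : (A * kappa c) i j = c *: (A i j).
  rewrite mul_matrix2 /kappa /= !mxE.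
  by case: (ord2P j) => -> /=; rewrite ?mulr0n ?mulr1n ?mulr0 ?addr0 ?add0r mulr_algr.
have kappa_comm c A : GRing.comm (kappa c) A.
  by apply/matrixP => i j; rewrite kappaE kappaEr.
pose u := triang x dx x; pose v := triang (y + t *: x) dy y.
(* The diagonal entries are the Jordan relations for (x, y + t x) and (x, y); the corner entry is
   exactly [dxy]. *)
have uv : u * v = v * u + u ^+ 2.
  rewrite expr2 !triangM triangD jshift_rel jordan_rel dxy -!expr2.
  by [].
have [ev [evM ev1 evx evy evZ]] : exists ev : {additive R -> 'M[R]_2},
    [/\ {morph ev : r s / r * s}, ev 1 = 1, ev x = u, ev y = v
      & forall c r, ev (c *: r) = kappa c * ev r].
  exists (jev kappa u v); have [evM ev1] := jev_is_multiplicative kappa_comm uv.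
  split=> //; [exact: jev_x | exact: jev_y | exact: jevZ].
have evE r : [/\ ev r ord0 ord0 = jshift t r, ev r ord_max ord0 = 0
    & ev r ord_max ord_max = r].
  elim/jordan_ind: r => [|c a [e1 e2 e3]|a b [a1 a2 a3] [b1 b2 b3]|a [e1 e2 e3]|a [e1 e2 e3]].
  - by rewrite ev1 rmorph1 !mxE.
  - by rewrite evZ !kappaE e1 e2 e3 scaler0 linearZ.
  - by rewrite raddfD !mxE a1 a2 a3 b1 b2 b3 addr0 raddfD.
  - by rewrite evM !mul_matrix2 evx e1 e2 e3 !mxE /= !mul0r !mulr0 !addr0 add0r
      rmorphM /= jshift_x.
  by rewrite evM !mul_matrix2 evy e1 e2 e3 !mxE /= !mul0r !mulr0 !addr0 add0r
      rmorphM /= jshift_y.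
pose d r := ev r ord0 ord_max.
have d_lin : linear d by move=> c r s; rewrite /d raddfD /= mxE evZ kappaE.
pose lin := GRing.isLinear.Build K R R *:%R d d_lin.
pose delta : {linear R -> R} := HB.pack d lin.
exists delta; rewrite /= /d evx evy !mxE; split=> // r s.
by rewrite /= evM mul_matrix2; have [-> _ _] := evE r; have [_ _ ->] := evE s.
Qed.

Lemma jordan_derivation_part (t : K) (delta : {linear R -> R}) n r :
    twisted_derivation (jshift t) delta -> jpart 2 (delta x) -> jpart 2 (delta y) ->
  jpart n r -> jpart n.+1 (delta r).
Proof.
move=> Hd dx dy; move: r; apply: jpart_ind => [c a|a b ha hb||j i <-].
- by rewrite linearZ; apply: jpartZ.
- by rewrite linearD; apply: jpartD.
- by rewrite raddf0; apply: jpart0.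
have step m a b : jpart m a -> jpart m.+1 (delta a) -> jpart 1 b -> jpart 2 (delta b) ->
    jpart m.+1 (a * b) /\ jpart m.+2 (delta (a * b)).
  move=> a_m da_m b1 db2; split; first by rewrite -addn1; apply: jpartM.
  rewrite Hd; apply: jpartD; last by rewrite -addn1; apply: jpartM.
  by rewrite -addn2; apply: jpartM => //; apply: jshift_part.
suff [_ //] : jpart (j + i) (y ^+ j * x ^+ i) /\ jpart (j + i).+1 (delta (y ^+ j * x ^+ i)).
elim: i => [|i [IH IHd]]; last first.
  by rewrite exprSr mulrA addnS; apply: step => //; apply: jpartx.
rewrite addn0 expr0 mulr1; elim: j => [|j [IH IHd]]; last first.
  by rewrite exprSr; apply: step => //; apply: jparty.
rewrite expr0 (twisted_derivation1 Hd); split; [exact: jpart1 | exact: jpart0].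
Qed.

Lemma jordan_derivation_exists : exists delta : {linear R -> R},
  [/\ twisted_derivation (jshift (- 2%:R)) delta,
      delta x = x ^+ 2 + y ^+ 2 *+ 3 & delta y = - (y ^+ 2 *+ 3) - (x * y) *+ 2].
Proof.
apply: jordan_derivation.
(* With this form of the relation, every x y inside a longer word is rewritten, which brings all
   words to the normal form y^j x^i. *)
have yx a : a * x * y = a * y * x + a * x * x.
  by rewrite -mulrA jordan_rel mulrDr expr2 !mulrA.
rewrite scaleNr scaler_nat !expr2.
rewrite !(mulrDl, mulrDr, mulNr, mulrN, mulrnAl, mulrnAr, mulrA, opprK).
rewrite !(yx, jordan_rel, expr2, mulrDl, mulrDr, mulrA).
(* Both sides are now combinations of the same words; taking coefficients moves the identity to the
   commutative field K, where [ring] decides it. *)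
apply: jcoef_inj => k.
have jcoefN r : jcoef (- r) k = - jcoef r k by rewrite -scaleN1r jcoefZ mulN1r.
have jcoefMn r n : jcoef (r *+ n) k = jcoef r k *+ n by rewrite -scaler_nat jcoefZ mulr_natl.
rewrite !(jcoefD, jcoefN, jcoefMn).
ring.
Qed.

End JordanDerivation.

Section JordanGrowth.
Variable K : fieldType.
Local Notation R := (jordan K).
Local Notation x := (jx K).
Local Notation y := (jy K).

Fact jeps_sig : {e : {rmorphism R -> K} |
  [/\ forall c : K, e c%:A = c, e x = 0 & e y = 0]}.
Proof.
have rel0 : 0 * 0 = 0 * 0 + 0 ^+ 2 :> (K^o : algType K) by rewrite mul0r expr2 mul0r addr0.
have ex := jhom_x rel0; have ey := jhom_y rel0.
exists (jhom rel0 : {rmorphism R -> K^o}); split=> [c||]; [|exact: ex|exact: ey].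
have e : jhom rel0 c%:A = c%:A :> (K^o : algType K) by rewrite linearZ rmorph1.
exact: etrans e (mulr1 c).
Qed.

Definition jeps : {rmorphism R -> K} := sval jeps_sig.

Lemma jeps_scalar (c : K) : jeps c%:A = c.
Proof. by have [] := svalP jeps_sig. Qed.

Lemma jeps_x : jeps x = 0. Proof. by have [] := svalP jeps_sig. Qed.
Lemma jeps_y : jeps y = 0. Proof. by have [] := svalP jeps_sig. Qed.

Lemma jepsZ c r : jeps (c *: r) = c * jeps r.
Proof. by rewrite -mulr_algl rmorphM /= jeps_scalar. Qed.

Lemma jeps_part n r : (0 < n)%N -> jpart n r -> jeps r = 0.
Proof.
move=> n0; move: r; apply: jpart_ind => [c a e0|a b a0 b0||j i ji].
- by rewrite jepsZ e0 mulr0.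
- by rewrite raddfD /= a0 b0 addr0.
- exact: raddf0.
rewrite rmorphM !rmorphXn /= jeps_x jeps_y.
case: i ji => [|i] ji; last by rewrite [0 ^+ _.+1]expr0n mulr0.
by case: j ji n0 => [<-|j _ _]; rewrite // expr0n mul0r.
Qed.

Lemma jpart0_scalar r : jpart 0 r -> r = (jeps r)%:A.
Proof.
move: r; apply: jpart_ind => [c a e0|a b a0 b0||[|j] [|i] //= _].
- by rewrite jepsZ -scalerA -e0.
- by rewrite raddfD /= scalerDl -a0 -b0.
- by rewrite raddf0 scale0r.
by rewrite !expr0 mulr1 rmorph1 scale1r.
Qed.

(** [dim_le] asks for exactly m vectors, so the n + 1 basis elements y^i x^(n-i) are padded with
    zeros. *)
Lemma jpart_dim n m : (n < m)%N -> dim_le (jpart (K := K) n) m.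
Proof.
move=> nm; pose b (i : 'I_m) : R := if (i <= n)%N then y ^+ i * x ^+ (n - i) else 0.
exists b; split=> [i|].
  rewrite /b; case: leqP => [le_in|_]; last exact: jpart0.
  by have := @jpart_basis K i (n - i); rewrite subnKC.
apply: jpart_ind => [c a [k ->]|a a' [k ->] [k' ->]||j i ji].
- by exists (fun i => c * k i); rewrite scaler_sumr; apply: eq_bigr => i _; rewrite scalerA.
- exists (fun i => k i + k' i); rewrite -big_split; apply: eq_bigr => i _.
  by rewrite scalerDl.
- by exists (fun=> 0); rewrite big1 // => i _; rewrite scale0r.
have le_jn : (j <= n)%N by rewrite -ji leq_addr.
pose J := Ordinal (leq_ltn_trans le_jn nm).
exists (fun i => (i == J)%:R); rewrite (bigD1 J) //= big1 => [|l /negbTE ->].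
  by rewrite eqxx scale1r addr0 /b /= le_jn -ji addKn.
by rewrite scale0r.
Qed.

Lemma jordan_augmentation : is_augmentation (A := jordan_graded K) jeps.
Proof. by split; [exact: jeps_scalar | exact: jeps_part]. Qed.

Lemma jordan_connected : connected (jordan_graded K).
Proof. by move=> a /jpart0_scalar a0; exists (jeps a). Qed.

Lemma jordan_generated : generated_in_degree1 (jordan_graded K).
Proof.
move=> B B1 B_1 BZ BD BM; apply: (@jordan_ind K B) => // [a Ba|a Ba].
  by apply: BM => //; apply/B1/jpartx.
by apply: BM => //; apply/B1/jparty.
Qed.

Lemma jordan_growth : polynomial_growth (jordan_graded K).
Proof.
(* The dimension n + 1 is at most 2 n for n > 0. *)
exists 2%N, 1%N => n n0; apply: jpart_dim.
by rewrite expn1 mul2n -addnn -[X in (X < _)%N]addn0 ltn_add2l.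
Qed.

End JordanGrowth.

(** * Induced modules *)

Section LinearSection.
Variables (K : fieldType) (V W : lmodType K) (p : {linear V -> W}).
Hypothesis p_surj : forall w, exists v, p v = w.

Definition subspace (G : V -> Prop) : Prop :=
  [/\ G 0, forall u v, G u -> G v -> G (u + v) & forall (c : K) v, G v -> G (c *: v)].

(* Zorn: a maximal subspace meeting the kernel trivially is a complement of it *)
Lemma kernel_complement : exists G : V -> Prop,
  [/\ subspace G, forall v, G v -> p v = 0 -> v = 0 & forall w, exists2 v, G v & p v = w].
Proof.
pose P (G : V -> Prop) := [/\ forall u v, G u -> G v -> G (u + v),
  forall (c : K) v, G v -> G (c *: v) & forall v, G v -> p v = 0 -> v = 0].
have [|A [[AD AZ Aker] Amax]] := @classical_sets.Zorn_bigcup V P.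
  move=> F FP Ftot; split=> [u v [X FX Xu] [Y FY Yv]|c v [X FX Xv]|v [X FX Xv]].
  - case: (Ftot X Y FX FY) => sub.
      by exists Y => //; have [YD _ _] := FP _ FY; apply: YD => //; apply: sub.
    by exists X => //; have [XD _ _] := FP _ FX; apply: XD => //; apply: sub.
  - by exists X => //; have [_ XZ _] := FP _ FX; apply: XZ.
  by have [_ _ Xker] := FP _ FX; apply: Xker.
(* The predicate [P] cannot ask for 0, as the union of the empty chain is empty; the maximal A
   contains 0 because otherwise 0 could be added. *)
have A0 : A 0.
  apply: boolp.contrapT => nA0.
  apply: (Amax (fun v => A v \/ v = 0)); first by split=> [v|/(_ 0)] /=; [left | auto].
  split=> [u v [Au|->] [Av|->]|c v [Av|->]|v [Av|//]].
  - by left; apply: AD.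
  - by rewrite addr0; left.
  - by rewrite add0r; left.
  - by rewrite addr0; right.
  - by left; apply: AZ.
  - by rewrite scaler0; right.
  exact: Aker.
exists A; split=> // w; apply: boolp.contrapT => nw.
have [v0 pv0] := p_surj w.
(* If w has no preimage in A, adjoining the line of v0 keeps the intersection with the kernel
   trivial, against maximality. *)
apply: (Amax (fun v => exists a c, A a /\ v = a + c *: v0)).
  split=> [a Aa|/(_ v0) sub]; first by exists a, 0; rewrite scale0r addr0.
  by apply: nw; exists v0 => //; apply: sub; exists 0, 1; rewrite scale1r add0r.
split=> [_ _ [a [c [Aa ->]]] [b [d [Ab ->]]]|c _ [a [d [Aa ->]]]|_ [a [c [Aa ->]]]].
- by exists (a + b), (c + d); rewrite scalerDl addrACA; split=> //; apply: AD.
- by exists (c *: a), (c * d); rewrite scalerDr scalerA; split=> //; apply: AZ.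
rewrite linearD linearZ /= pv0 => pac; have [c0|c_neq0] := eqVneq c 0.
  by move: pac; rewrite c0 !scale0r !addr0; apply: Aker.
(* Solves p a + c w = 0 for w. *)
case: nw; exists (- c^-1 *: a); first exact: AZ.
rewrite linearZ /= -[p a](addrK (c *: w)) pac sub0r scalerN scaleNr opprK.
by rewrite scalerA mulVf // scale1r.
Qed.

Lemma linear_section : exists s : {linear W -> V}, forall w, p (s w) = w.
Proof.
have [G [[G0 GD GZ] Gker Gsurj]] := kernel_complement.
have ex w : exists v, G v /\ p v = w by have [v Gv pv] := Gsurj w; exists v.
have [s sE] := boolp.choice ex.
have uniq_pre v v' : G v -> G v' -> p v = p v' -> v = v'.
  move=> Gv Gv' e; apply/eqP; rewrite -subr_eq0; apply/eqP/Gker.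
    by rewrite -scaleN1r; apply/GD/GZ.
  by rewrite raddfB /= e subrr.
have s_lin : linear s.
  move=> c u w; apply: uniq_pre; first by case: (sE (c *: u + w)).
    by apply: GD; [apply: GZ|]; case: (sE u) (sE w) => ? ? [].
  rewrite linearP /=; case: (sE u) (sE w) (sE (c *: u + w)) => _ -> [_ ->] [_ ->] //.
pose lin := GRing.isLinear.Build K W V *:%R s s_lin.
pose f : {linear W -> V} := HB.pack s lin.
by exists f => w /=; case: (sE w).
Qed.

End LinearSection.

Section MalgSum.
Variables (I : choiceType) (W U : zmodType) (F : I -> {additive W -> U}).

(** The universal property of [{malg W[I]}] seen as a direct sum of copies of the group W. *)
Fact malg_sum_sig : {f : {additive {malg W[I]} -> U} |
  forall k w, f << w *g k >> = F k w}.
Proof.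
pose g (e : {malg W[I]}) := \sum_(k <- msupp e) F k e@_k.
have gEw (d : {fset I}) e : (msupp e `<=` d)%fset -> g e = \sum_(k <- d) F k e@_k.
  move=> le; rewrite [LHS](big_fset_incl _ le) // => k _ /mcoeff_outdom ->.
  by rewrite raddf0.
have g_add : additive g.
  move=> e e'; pose d := (msupp e `|` msupp e')%fset.
  rewrite (gEw d (e - e')) ?msuppB_le // (gEw d e) ?fsubsetUl // (gEw d e') ?fsubsetUr //.
  by rewrite -sumrB; apply: eq_bigr => k _; rewrite mcoeffB raddfB.
pose add := GRing.isAdditive.Build {malg W[I]} U g g_add.
pose f : {additive {malg W[I]} -> U} := HB.pack g add.
exists f => k w /=; rewrite (gEw [fset k]%fset) ?msuppU_le // big_seq_fset1.
by rewrite mcoeffUU.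
Qed.

Definition malg_sum : {additive {malg W[I]} -> U} := sval malg_sum_sig.

Lemma malg_sumU k w : malg_sum << w *g k >> = F k w.
Proof. exact: (svalP malg_sum_sig). Qed.

End MalgSum.

Section Restriction.
Variables (K : fieldType) (Q : lmodType (jordan K)).

Definition restrict : Type := Q.

HB.instance Definition _ := GRing.Zmodule.on restrict.

Definition restrict_scale (c : K) (q : restrict) : restrict := (c%:A *: (q : Q) : Q).

Fact restrict_scaleA c d q : restrict_scale c (restrict_scale d q) = restrict_scale (c * d) q.
Proof. by rewrite /restrict_scale scalerA mulr_algl scalerA. Qed.
Fact restrict_scale1 : left_id 1 restrict_scale.
Proof. by move=> q; rewrite /restrict_scale !scale1r. Qed.
Fact restrict_scaleDr : right_distributive restrict_scale +%R.
Proof. by move=> c q q'; rewrite /restrict_scale scalerDr. Qed.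
Fact restrict_scaleDl q : {morph restrict_scale^~ q : c d / c + d}.
Proof. by move=> c d; rewrite /restrict_scale !scalerDl. Qed.

HB.instance Definition _ := GRing.Zmodule_isLmodule.Build K restrict
  restrict_scaleA restrict_scale1 restrict_scaleDr restrict_scaleDl.

Lemma restrictZ (c : K) (q : restrict) : c *: q = (c%:A *: (q : Q) : Q).
Proof. by []. Qed.

End Restriction.

Section Induced.
Variables (K : fieldType) (N : lmodType K).
Local Notation R := (jordan K).
Local Notation x := (jx K).
Local Notation y := (jy K).
Local Notation b k := (y ^+ k.1 * x ^+ k.2).

(* R (x)_K N, in the coordinates given by the basis y^j x^i of R *)
Definition induced : Type := {malg N[(nat * nat)%type]}.

HB.instance Definition _ := GRing.Zmodule.on induced.

Fact tensor_sig : {t : R -> N -> induced |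
  forall r n k, (t r n : {malg N[(nat * nat)%type]})@_k = jcoef r k *: n}.
Proof.
exists (fun r n => \sum_(k <- msupp (jcoords r)) << jcoef r k *: n *g k >>) => r n k.
rewrite -mcoeff_jcoords.
have -> : \sum_(l <- msupp (jcoords r)) << jcoef r l *: n *g l >> =
    [malg l in msupp (jcoords r) => (jcoords r)@_l *: n] :> {malg N[(nat * nat)%type]}.
  rewrite [RHS](monalgEw (domg := msupp (jcoords r))).
    by rewrite !big_seq; apply: eq_bigr => l lr; rewrite mcoeffE lr mcoeff_jcoords.
  by apply/fsubsetP => l; rewrite -mcoeff_neq0 mcoeffE; case: ifP => // _; rewrite eqxx.
rewrite mcoeffE; case: ifP => // /negbT /mcoeff_outdom ->.
by rewrite scale0r.
Qed.

Definition tensor := sval tensor_sig.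

Lemma mcoeff_tensor r n k :
  (tensor r n : {malg N[(nat * nat)%type]})@_k = jcoef r k *: n.
Proof. exact: (svalP tensor_sig). Qed.

Lemma induced_eq (e e' : induced) :
  (forall k, (e : {malg N[(nat * nat)%type]})@_k = (e' : {malg N[(nat * nat)%type]})@_k) ->
  e = e'.
Proof. by move=> h; apply/malgP. Qed.

Lemma tensorDl r s n : tensor (r + s) n = tensor r n + tensor s n.
Proof. by apply: induced_eq => k; rewrite mcoeffD !mcoeff_tensor jcoefD scalerDl. Qed.

Lemma tensorDr r n m : tensor r (n + m) = tensor r n + tensor r m.
Proof. by apply: induced_eq => k; rewrite mcoeffD !mcoeff_tensor scalerDr. Qed.

Lemma tensorZ c r n : tensor (c *: r) n = tensor r (c *: n).
Proof. by apply: induced_eq => k; rewrite !mcoeff_tensor jcoefZ scalerA mulrC. Qed.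

Lemma tensor0r r : tensor r 0 = 0.
Proof. by apply: induced_eq => k; rewrite mcoeff0 mcoeff_tensor scaler0. Qed.

Lemma tensor0l n : tensor 0 n = 0.
Proof. by rewrite -(scale0r 1) tensorZ scale0r tensor0r. Qed.

Lemma tensorNr r n : tensor r (- n) = - tensor r n.
Proof. by apply/eqP; rewrite -addr_eq0 -tensorDr addNr tensor0r. Qed.

Lemma tensor_suml (J : Type) (s : seq J) (f : J -> R) n :
  tensor (\sum_(i <- s) f i) n = \sum_(i <- s) tensor (f i) n.
Proof. by apply: (big_morph (tensor^~ n) (fun r s => tensorDl r s n)); apply: tensor0l. Qed.

Lemma tensor_basis k n : tensor (b k) n = << n *g k >>.
Proof.
apply: induced_eq => l; rewrite mcoeff_tensor jcoef_basis mcoeffU eq_sym; case: k => j i /=.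
by rewrite mulrb; case: eqP => _; rewrite ?scale1r ?scale0r.
Qed.

Lemma induced_ind (P : induced -> Prop) :
    (forall e e', P e -> P e' -> P (e + e')) -> (forall r n, P (tensor r n)) ->
  forall e, P e.
Proof.
move=> PD Pt e; rewrite (monalgE (e : {malg N[(nat * nat)%type]})).
elim: (X in \sum_(k <- X) _) => [|k s IH].
  by rewrite big_nil -(tensor0l 0).
by rewrite big_cons -tensor_basis; apply: PD.
Qed.

Fact tensor_additive r : additive (tensor r).
Proof. by move=> n m; rewrite tensorDr tensorNr. Qed.

HB.instance Definition _ r := GRing.isAdditive.Build N induced (tensor r) (tensor_additive r).

Lemma tensor_coords r n :
  tensor r n = \sum_(k <- msupp (jcoords r)) << jcoef r k *: n *g k >>.
Proof.
rewrite -{1}(jcoordsK r) tensor_suml; apply: eq_bigr => k _.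
by rewrite tensorZ tensor_basis.
Qed.

Definition induced_scale (r : R) (e : induced) : induced :=
  malg_sum (fun k => tensor (r * b k) : {additive N -> induced}) e.

Lemma induced_scale_tensor r s n : induced_scale r (tensor s n) = tensor (r * s) n.
Proof.
rewrite /induced_scale tensor_coords raddf_sum -[s in RHS]jcoordsK mulr_sumr tensor_suml.
by apply: eq_bigr => k _; rewrite [LHS]malg_sumU /= -scalerAr tensorZ.
Qed.

Fact induced_scaleDr : right_distributive induced_scale +%R.
Proof. by move=> r e e'; rewrite /induced_scale raddfD. Qed.

Fact induced_scaleDl e : {morph induced_scale^~ e : r s / r + s}.
Proof.
move=> r s /=; elim/induced_ind: e => [e e' IH IH'|t n].
  by rewrite !induced_scaleDr IH IH' addrACA.
by rewrite !induced_scale_tensor mulrDl tensorDl.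
Qed.

Fact induced_scaleA r s e : induced_scale r (induced_scale s e) = induced_scale (r * s) e.
Proof.
elim/induced_ind: e => [e e' IH IH'|t n].
  by rewrite !induced_scaleDr IH IH'.
by rewrite !induced_scale_tensor mulrA.
Qed.

Fact induced_scale1 : left_id 1 induced_scale.
Proof.
elim/induced_ind => [e e' IH IH'|t n]; first by rewrite !induced_scaleDr IH IH'.
by rewrite induced_scale_tensor mul1r.
Qed.

HB.instance Definition _ := GRing.Zmodule_isLmodule.Build R induced
  induced_scaleA induced_scale1 induced_scaleDr induced_scaleDl.

Lemma scale_tensor (r s : R) n : r *: (tensor s n : induced) = tensor (r * s) n.
Proof. exact: induced_scale_tensor. Qed.

Lemma induced_lin_ext (Q : lmodType R) (f g : {linear induced -> Q}) :
  (forall n, f (tensor 1 n) = g (tensor 1 n)) -> f =1 g.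
Proof.
move=> fg; elim/induced_ind => [e e' IH IH'|r n]; first by rewrite !raddfD /= IH IH'.
by rewrite -[r]mulr1 -scale_tensor !linearZ /= fg.
Qed.

Section Lift.
Variables (Q : lmodType R) (f : {linear N -> restrict Q}).

Definition lift_coef (r : R) (n : N) : Q := r *: (f n : Q).

Fact lift_coef_additive r : additive (lift_coef r).
Proof. by move=> n m; rewrite /lift_coef raddfB scalerBr. Qed.

HB.instance Definition _ r := GRing.isAdditive.Build N Q (lift_coef r) (lift_coef_additive r).

(** Existence in the adjunction between induction and restriction; uniqueness is
    [induced_lin_ext]. *)
Fact induced_lift_sig : {g : {linear induced -> Q} |
  forall r n, g (tensor r n) = r *: (f n : Q)}.
Proof.
pose g : {additive induced -> Q} :=
  malg_sum (fun k => lift_coef (b k) : {additive N -> Q}).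
have gE r n : g (tensor r n) = r *: (f n : Q).
  rewrite tensor_coords raddf_sum /= -[r in RHS]jcoordsK scaler_suml; apply: eq_bigr => k _.
  rewrite [LHS]malg_sumU /= /lift_coef linearZ /= restrictZ scalerA mulr_algr.
  by [].
have g_scal : scalable g.
  move=> r e; elim/induced_ind: e => [e e' IH IH'|s n].
    by rewrite scalerDr !raddfD /= IH IH'.
  by rewrite scale_tensor !gE scalerA.
pose scal := GRing.isScalable.Build R induced Q *:%R g g_scal.
pose h : {linear induced -> Q} := HB.pack (g : induced -> Q) scal (GRing.Additive.on g).
by exists h.
Qed.

Definition induced_lift : {linear induced -> Q} := sval induced_lift_sig.

Lemma induced_liftE r n : induced_lift (tensor r n) = r *: (f n : Q).
Proof. exact: (svalP induced_lift_sig). Qed.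

End Lift.

End Induced.

Section ProjectiveInduced.
Variable K : fieldType.
Local Notation R := (jordan K).

Fact restrict_linear (M N : lmodType R) (p : {linear M -> N}) :
  linear (p : restrict M -> restrict N).
Proof. by move=> c u v; rewrite [LHS]linearP. Qed.

Lemma tensor_linear (N : lmodType K) (Q : lmodType R) (f : {linear induced N -> Q}) :
  linear (fun n => f (tensor 1 n) : restrict Q).
Proof.
move=> c n m; rewrite tensorDr raddfD /= -tensorZ; congr (_ + _).
by rewrite restrictZ -linearZ scale_tensor mulr1.
Qed.

Lemma induced_projective (N : lmodType K) : projective (induced N).
Proof.
move=> M Q p f p_surj.
pose p_lin := GRing.isLinear.Build K (restrict M) (restrict Q) *:%R
  (p : restrict M -> restrict Q) (@restrict_linear M Q p).
pose pK : {linear restrict M -> restrict Q} := HB.pack (p : restrict M -> restrict Q) p_lin.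
have [s sE] := @linear_section K (restrict M) (restrict Q) pK p_surj.
pose g0 (n : N) : restrict M := s (f (tensor 1 n)).
have g0_lin : linear g0.
  by move=> c n m; rewrite /g0 (tensor_linear f) linearP.
pose g_lin := GRing.isLinear.Build K N (restrict M) *:%R g0 g0_lin.
pose g : {linear N -> restrict M} := HB.pack g0 g_lin.
exists (induced_lift g); apply: (@induced_lin_ext _ _ _ (p \o induced_lift g) f) => n /=.
rewrite induced_liftE scale1r; exact: sE.
Qed.

End ProjectiveInduced.

Section KLinear.
Variable K : fieldType.
Local Notation R := (jordan K).
Variables (V : lmodType K).

(** K-linearity of a map into an R-module, stated without passing to [restrict], so that
    differentials can be assembled as sums of elementary maps. *)
Definition klin (Q : lmodType R) (f : V -> Q) : Prop :=
  forall (c : K) u v, f (c *: u + v) = c%:A *: f u + f v.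

Lemma klinD (Q : lmodType R) (f g : V -> Q) : klin f -> klin g -> klin (fun v => f v + g v).
Proof. by move=> hf hg c u v; rewrite hf hg scalerDr addrACA. Qed.

Lemma klinB (Q : lmodType R) (f g : V -> Q) : klin f -> klin g -> klin (fun v => f v - g v).
Proof. by move=> hf hg c u v; rewrite hf hg scalerBr opprD addrACA. Qed.

Lemma klin_tensor (W : lmodType K) (a : R) (f : {linear V -> W}) :
  klin (fun v => tensor a (f v)).
Proof.
by move=> c v w; rewrite linearP tensorDr scale_tensor mulr_algl tensorZ.
Qed.

Fact klift_sig (Q : lmodType R) (f : V -> Q) (hf : klin f) :
  {g : {linear induced V -> Q} | forall r v, g (tensor r v) = r *: f v}.
Proof.
pose lin := GRing.isLinear.Build K V (restrict Q) *:%R (f : V -> restrict Q) hf.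
pose g : {linear V -> restrict Q} := HB.pack (f : V -> restrict Q) lin.
by exists (induced_lift g) => r v; rewrite induced_liftE.
Qed.

Definition klift (Q : lmodType R) (f : V -> Q) (hf : klin f) : {linear induced V -> Q} :=
  sval (klift_sig hf).

Lemma kliftE (Q : lmodType R) (f : V -> Q) (hf : klin f) r v :
  klift hf (tensor r v) = r *: f v.
Proof. exact: (svalP (klift_sig hf)). Qed.

End KLinear.

(** * The Koszul resolution *)

Section InducedKoszul.
Variables (K : fieldType) (M : lmodType (jordan K)).
Local Notation R := (jordan K).
Local Notation x := (jx K).
Local Notation y := (jy K).
Local Notation N := (restrict M).
Local Notation E := (induced N).
Local Notation F := (induced (N * N)%type).
Local Notation b k := (y ^+ k.1 * x ^+ k.2).
Implicit Types (r a : R) (m : N) (e c : E).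

Definition mact (a : R) (m : N) : N := (a *: (m : M) : M).

Lemma mactZ a (c : K) m : mact a (c *: m) = c *: mact a m.
Proof. by rewrite /mact !restrictZ !scalerA mulr_algl mulr_algr. Qed.

Lemma mactD a m m' : mact a (m + m') = mact a m + mact a m'.
Proof. exact: (@scalerDr _ M). Qed.

Lemma mactDl a a' m : mact (a + a') m = mact a m + mact a' m.
Proof. exact: (@scalerDl _ M). Qed.

Lemma mactA a a' m : mact a (mact a' m) = mact (a * a') m.
Proof. exact: (@scalerA _ M). Qed.

Lemma mact1 m : mact 1 m = m.
Proof. exact: (@scale1r _ M). Qed.

Fact mact_is_linear a : linear (mact a).
Proof. by move=> c m m'; rewrite mactD mactZ. Qed.

HB.instance Definition _ a := GRing.isLinear.Build K N N *:%R (mact a) (mact_is_linear a).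

Definition in1 (m : N) : (N * N)%type := (m, 0).
Definition in2 (m : N) : (N * N)%type := (0, m).

Fact in1_is_linear : linear in1.
Proof. by move=> c m m'; congr pair; rewrite /= scaler0 addr0. Qed.

Fact in2_is_linear : linear in2.
Proof. by move=> c m m'; congr pair; rewrite /= scaler0 addr0. Qed.

HB.instance Definition _ := GRing.isLinear.Build K N (N * N)%type *:%R in1 in1_is_linear.
HB.instance Definition _ := GRing.isLinear.Build K N (N * N)%type *:%R in2 in2_is_linear.

(** The difference between the two ways of letting a act in the middle of R (x) M: on R from the
    right, and on M from the left. Its image dies under r (x) m |-> r m. *)
Fact kdiff_sig a : {f : {linear E -> E} |
  forall r m, f (tensor r m) = tensor (r * a) m - tensor r (mact a m)}.
Proof.
exists (klift (klinB (klin_tensor a idfun) (klin_tensor 1 (mact a)))) => r m.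
by rewrite kliftE scalerBr !scale_tensor mulr1.
Qed.

Definition kdiff a : {linear E -> E} := sval (kdiff_sig a).
Definition kfst : {linear F -> E} := klift (klin_tensor 1 fst).
Definition ksnd : {linear F -> E} := klift (klin_tensor 1 snd).
Definition kin1 : {linear E -> F} := klift (klin_tensor 1 in1).
Definition kin2 : {linear E -> F} := klift (klin_tensor 1 in2).
Definition kz : {linear E -> E} :=
  klift (klinD (klinB (klin_tensor y idfun) (klin_tensor 1 (mact y)))
               (klinD (klin_tensor x idfun) (klin_tensor 1 (mact x)))).

Fact koszul0_sig : {f : {linear F -> E} | forall p, f p = kdiff x (kfst p) + kdiff y (ksnd p)}.
Proof. by exists ((kdiff x \o kfst) \+ (kdiff y \o ksnd)). Qed.

Definition koszul0 : {linear F -> E} := sval koszul0_sig.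

Lemma koszul0E p : koszul0 p = kdiff x (kfst p) + kdiff y (ksnd p).
Proof. exact: (svalP koszul0_sig). Qed.

Fact koszul1_sig : {f : {linear E -> F} | forall c, f c = kin2 (kdiff x c) - kin1 (kz c)}.
Proof. by exists ((kin2 \o kdiff x) \- (kin1 \o kz)). Qed.

Definition koszul1 : {linear E -> F} := sval koszul1_sig.

Lemma koszul1E c : koszul1 c = kin2 (kdiff x c) - kin1 (kz c).
Proof. exact: (svalP koszul1_sig). Qed.

Fact id_restrict_klin : klin (fun m : N => (m : M)).
Proof. by move=> c m m'. Qed.

Definition kaug : {linear E -> M} := klift id_restrict_klin.

Lemma kdiffE a r m : kdiff a (tensor r m) = tensor (r * a) m - tensor r (mact a m).
Proof. exact: (svalP (kdiff_sig a)). Qed.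

Lemma kfstE r p : kfst (tensor r p) = tensor r p.1.
Proof. by rewrite kliftE scale_tensor mulr1. Qed.

Lemma ksndE r p : ksnd (tensor r p) = tensor r p.2.
Proof. by rewrite kliftE scale_tensor mulr1. Qed.

Lemma kin1E r m : kin1 (tensor r m) = tensor r (in1 m).
Proof. by rewrite kliftE scale_tensor mulr1. Qed.

Lemma kin2E r m : kin2 (tensor r m) = tensor r (in2 m).
Proof. by rewrite kliftE scale_tensor mulr1. Qed.

Lemma kzE r m : kz (tensor r m) =
  tensor (r * y) m - tensor r (mact y m) + (tensor (r * x) m + tensor r (mact x m)).
Proof. by rewrite kliftE !scalerDr scalerN !scale_tensor !mulr1. Qed.

Lemma koszul0_tensor r p : koszul0 (tensor r p) =
  tensor (r * x) p.1 - tensor r (mact x p.1) + (tensor (r * y) p.2 - tensor r (mact y p.2)).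
Proof. by rewrite koszul0E kfstE ksndE !kdiffE. Qed.

Lemma koszul1_tensor r m : koszul1 (tensor r m) =
  tensor (r * x) (in2 m) - tensor r (in2 (mact x m)) -
  (tensor (r * y) (in1 m) - tensor r (in1 (mact y m)) +
   (tensor (r * x) (in1 m) + tensor r (in1 (mact x m)))).
Proof. by rewrite koszul1E kdiffE kzE !raddfD !raddfN /= !kin2E !kin1E. Qed.

Lemma kaugE r m : kaug (tensor r m) = r *: (m : M).
Proof. exact: kliftE. Qed.

Lemma kfst_in1 c : kfst (kin1 c) = c.
Proof. by elim/induced_ind: c => [c c' IH IH'|r m]; rewrite ?raddfD /= ?IH ?IH' // kin1E kfstE. Qed.

Lemma kfst_in2 c : kfst (kin2 c) = 0.
Proof.
elim/induced_ind: c => [c c' IH IH'|r m]; first by rewrite !raddfD /= IH IH' addr0.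
by rewrite kin2E kfstE tensor0r.
Qed.

Lemma ksnd_in1 c : ksnd (kin1 c) = 0.
Proof.
elim/induced_ind: c => [c c' IH IH'|r m]; first by rewrite !raddfD /= IH IH' addr0.
by rewrite kin1E ksndE tensor0r.
Qed.

Lemma ksnd_in2 c : ksnd (kin2 c) = c.
Proof. by elim/induced_ind: c => [c c' IH IH'|r m]; rewrite ?raddfD /= ?IH ?IH' // kin2E ksndE. Qed.

Lemma kpair_inj (e e' : F) : kfst e = kfst e' -> ksnd e = ksnd e' -> e = e'.
Proof.
have split_in (f : F) : f = kin1 (kfst f) + kin2 (ksnd f).
  elim/induced_ind: f => [f f' IH IH'|r p].
    by rewrite {1}IH {1}IH' !raddfD /= addrACA.
  rewrite kfstE ksndE kin1E kin2E -tensorDr; congr tensor; case: p => m m'.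
  by congr pair; rewrite /= ?addr0 ?add0r.
by move=> e1 e2; rewrite (split_in e) e1 e2 -split_in.
Qed.

Lemma kfst_koszul1 c : kfst (koszul1 c) = - kz c.
Proof. by rewrite koszul1E raddfB /= kfst_in1 kfst_in2 sub0r. Qed.

Lemma ksnd_koszul1 c : ksnd (koszul1 c) = kdiff x c.
Proof. by rewrite koszul1E raddfB /= ksnd_in1 ksnd_in2 subr0. Qed.

(** Let rho and lambda denote right multiplication on R and action on M. The Jordan relation
    contributes rho(x)^2 to the commutator of the two differences and -lambda(x)^2 from the reversed
    order on M. Together these are (rho(x) - lambda(x)) (rho(x) + lambda(x)), whence the last two
    terms of [kz]. *)
Lemma kdiff_comm c : kdiff y (kdiff x c) = kdiff x (kz c).
Proof.
elim/induced_ind: c => [c c' IH IH'|r m]; first by rewrite !raddfD /= IH IH'.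
rewrite kdiffE kzE !raddfD !raddfN /= !kdiffE !mactA -!mulrA.
have xy : x * y = y * x + x * x by rewrite jordan_rel expr2.
rewrite xy mulrDr tensorDl mactDl tensorDr subrKA !opprB.
(* Summands 4 and 7 are the opposite terms in r (x) x^2 m. *)
by rewrite [RHS](AC (2*3*2) ((1*6*5*(3*2))*(4*7))) /= addrN addr0.
Qed.

(* Reduction modulo the image of [kdiff x]: y^j x^i (x) m |-> y^j (x) x^i m *)
Definition kpi_coef (k : nat * nat) (m : N) : {malg N[nat]} := << mact (x ^+ k.2) m *g k.1 >>.

Fact kpi_coef_additive k : additive (kpi_coef k).
Proof. by move=> m m'; rewrite /kpi_coef !raddfB. Qed.

HB.instance Definition _ k :=
  GRing.isAdditive.Build N {malg N[nat]} (kpi_coef k) (kpi_coef_additive k).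

Definition kpi : {additive {malg N[(nat * nat)%type]} -> {malg N[nat]}} :=
  malg_sum (fun k => kpi_coef k : {additive N -> {malg N[nat]}}).

Lemma kpiE k m : kpi (tensor (b k) m) = << mact (x ^+ k.2) m *g k.1 >>.
Proof. by rewrite tensor_basis [LHS]malg_sumU. Qed.

Lemma induced_basis_ind (P : E -> Prop) :
    (forall e e', P e -> P e' -> P (e + e')) ->
    (forall j i m, P (tensor (y ^+ j * x ^+ i) m)) -> forall e, P e.
Proof.
move=> PD Pb; apply: induced_ind => // r; elim/jordan_lin_ind: r => [c r IH|r s IH IH'|j i] m //.
  by rewrite tensorZ.
by rewrite tensorDl; apply: PD.
Qed.

Lemma kpi_kdiffx e : kpi (kdiff x e) = 0.
Proof.
elim/induced_basis_ind: e => [e e' IH IH'|j i m].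
  by rewrite raddfD [LHS]raddfD /= IH IH' addr0.
rewrite kdiffE -mulrA -exprSr [LHS]raddfB /= (kpiE (j, i.+1)) (kpiE (j, i)) /=.
by rewrite mactA -exprSr subrr.
Qed.

(** The component on y^j (x) m of the map that [kdiff y] induces on the cokernel of [kdiff x]. *)
Definition kshift_coef (j : nat) (m : N) : {malg N[nat]} :=
  << m *g j.+1 >> - << mact y m *g j >>.

Fact kshift_coef_additive k : additive (kshift_coef k).
Proof. by move=> m m'; rewrite /kshift_coef !raddfB /= ?opprD !opprK addrACA. Qed.

HB.instance Definition _ k :=
  GRing.isAdditive.Build N {malg N[nat]} (kshift_coef k) (kshift_coef_additive k).

Definition kshift : {additive {malg N[nat]} -> {malg N[nat]}} :=
  malg_sum (fun j => kshift_coef j : {additive N -> {malg N[nat]}}).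

(** Moving y past x^i produces the term i x^(i+1) both in R and in the action on M; after [kpi] the
    two coincide and cancel. *)
Lemma kpi_kdiffy e : kpi (kdiff y e) = kshift (kpi e).
Proof.
elim/induced_basis_ind: e => [e e' IH IH'|j i m].
  by rewrite raddfD [LHS]raddfD /= IH IH' -raddfD -[RHS]/(kshift (kpi _)) [in RHS]raddfD.
rewrite kdiffE -mulrA pow_rel mulrDr mulrA -exprSr mulrnAr tensorDl.
rewrite -scaler_nat tensorZ [LHS]raddfB [in LHS]raddfD /=.
rewrite (kpiE (j.+1, i)) (kpiE (j, i.+1)) (kpiE (j, i) (mact y m)) (kpiE (j, i) m) /=.
rewrite [RHS]malg_sumU /= /kshift_coef !mactA pow_rel mactDl raddfD /=.
by rewrite mulr_algr scaler_nat opprD addrACA subrr addr0.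
Qed.

(** Modulo the image, y^j x^(i+1) (x) m is y^j x^i (x) x m, so the powers of x cross the tensor sign
    one at a time. *)
Lemma kdiffx_cokernel e : exists c,
  e = kdiff x c + malg_sum (fun j => tensor (y ^+ j) : {additive N -> E}) (kpi e).
Proof.
elim/induced_basis_ind: e => [e e' [c IH] [c' IH']|j i m].
  exists (c + c'); rewrite !raddfD /= {1}IH {1}IH' addrACA; congr (_ + _).
elim: i m => [|i IH] m.
  exists 0; rewrite raddf0 add0r (kpiE (j, 0%N)) malg_sumU /= expr0 mact1.
  by rewrite mulr1.
have [c cE] := IH (mact x m); exists (tensor (y ^+ j * x ^+ i) m + c).
move: cE; rewrite (kpiE (j, i.+1)) (kpiE (j, i)) /= mactA -exprSr => cE.
by rewrite raddfD /= kdiffE -mulrA -exprSr -addrA -cE subrK.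
Qed.

Lemma kdiffx_ker e : kpi e = 0 -> exists c, e = kdiff x c.
Proof.
by have [c cE] := kdiffx_cokernel e; move=> e0; exists c; rewrite {1}cE e0 raddf0 addr0.
Qed.

(** Iterating the recursion pushes the index beyond the finite support, because s raises the weight;
    so each coefficient is an iterate of h at 0. This gives injectivity of both [kdiff x] and
    [kshift]. *)
Lemma finite_support_shift0 (I : choiceType) (u : {malg N[I]}) (s : I -> I) (h : N -> N) (w : I -> nat) :
    h 0 = 0 -> (forall k, w (s k) = (w k).+1) -> (forall k, u@_k = h u@_(s k)) -> u = 0.
Proof.
move=> h0 ws us; have uiter n k : u@_k = iter n h u@_(iter n s k).
  by elim: n k => // n IH k; rewrite iterSr /= -us -IH.
have witer n k : w (iter n s k) = (w k + n)%N.
  by elim: n => [|n IH]; rewrite ?addn0 //= ws IH addnS.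
apply/malgP => k; rewrite mcoeff0; pose n := \max_(l <- msupp u) (w l).+1.
rewrite (uiter n) mcoeff_outdom; first by elim: (n) => //= n' ->.
apply/negP => lu; have := @leq_bigmax_seq _ (enum_fset (msupp u)) xpredT (fun l => (w l).+1) _ lu isT.
by rewrite -/n witer ltnNge leq_addl.
Qed.

Lemma mcoeff_kdiffx e k : (kdiff x e : {malg N[(nat * nat)%type]})@_k =
  (if k.2 == 0%N then 0 else (e : {malg N[(nat * nat)%type]})@_(k.1, k.2.-1))
  - mact x (e : {malg N[(nat * nat)%type]})@_k.
Proof.
elim/induced_ind: e => [e e' IH IH'|r m].
  rewrite raddfD !mcoeffD IH IH' mactD; case: ifP => _.
    by rewrite !sub0r opprD.
  by rewrite opprD addrACA.
rewrite kdiffE mcoeffB !mcoeff_tensor mactZ; case: k => j i /=.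
by rewrite jcoef_mulx; case: ifP => _; rewrite ?scale0r.
Qed.

Lemma kdiffx_inj e : kdiff x e = 0 -> e = 0.
Proof.
move=> Xe; apply: (@finite_support_shift0 _ e (fun k => (k.1, k.2.+1)) (mact x) snd) => //.
  exact: raddf0.
move=> [j i] /=; apply/eqP; rewrite -subr_eq0; apply/eqP.
by rewrite -(mcoeff_kdiffx e (j, i.+1)) Xe mcoeff0.
Qed.

Lemma mcoeff_kshift (q : {malg N[nat]}) j :
  (kshift q)@_j = (if j == 0%N then 0 else q@_j.-1) - mact y q@_j.
Proof.
rewrite (monalgE q); elim: (X in \sum_(i <- X) _) => [|i s IH].
  by rewrite big_nil raddf0 !mcoeff0 raddf0 subr0 if_same.
rewrite big_cons raddfD !mcoeffD [X in X + _ = _](_ : _ =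
    (if j == 0%N then 0 else << q@_i *g i >>@_j.-1) - mact y << q@_i *g i >>@_j).
  by rewrite IH mactD; case: ifP => _; rewrite ?sub0r opprD // addrACA.
rewrite malg_sumU /kshift_coef mcoeffB !mcoeffU [in RHS]raddfMn /=; congr (_ - _).
by case: j {IH}.
Qed.

Lemma kshift_inj q : kshift q = 0 -> q = 0.
Proof.
move=> Sq; apply: (@finite_support_shift0 _ q S (mact y) id) => //.
  exact: raddf0.
move=> j; apply/eqP; rewrite -subr_eq0; apply/eqP.
by rewrite -(mcoeff_kshift q j.+1) Sq mcoeff0.
Qed.

(** A mapping cone argument. If [kdiff x] p + [kdiff y] q = 0, then q vanishes in the cokernel of
    [kdiff x] since [kshift] is injective there, so q = [kdiff x] c; cancelling the injective
    [kdiff x] leaves p = - [kz] c. *)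
Lemma koszul0_exact (f : F) : koszul0 f = 0 <-> exists c, koszul1 c = f.
Proof.
split=> [f0|[c <-]]; last first.
  rewrite koszul0E kfst_koszul1 ksnd_koszul1 kdiff_comm raddfN /=.
  exact: addNr.
have [c fc] : exists c, ksnd f = kdiff x c.
  apply: kdiffx_ker; apply: kshift_inj; rewrite -kpi_kdiffy.
  have := congr1 kpi f0; rewrite koszul0E raddf0 [LHS]raddfD /= kpi_kdiffx add0r; exact.
exists c; apply: kpair_inj; rewrite ?kfst_koszul1 ?ksnd_koszul1 //.
apply/eqP; rewrite eq_sym -addr_eq0; apply/eqP; apply: kdiffx_inj.
by rewrite raddfD /= -kdiff_comm -fc -koszul0E.
Qed.

Lemma koszul1_exact c : koszul1 c = 0 -> c = 0.
Proof. by move=> c0; apply: kdiffx_inj; rewrite -ksnd_koszul1 c0 raddf0. Qed.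

Lemma kaug_exact e : kaug e = 0 <-> exists f, koszul0 f = e.
Proof.
have k0in (a a' : E) : koszul0 (kin1 a + kin2 a') = kdiff x a + kdiff y a'.
  rewrite koszul0E !raddfD /= kfst_in1 kfst_in2 ksnd_in1 ksnd_in2.
  by rewrite !raddf0 addr0 add0r.
have koszul0D (f f' : F) : koszul0 (f + f') = koszul0 f + koszul0 f' by exact: raddfD.
have aug_diff a (c : E) : kaug (kdiff a c) = 0.
  elim/induced_ind: c => [c c' IH IH'|r m]; first by rewrite !raddfD /= IH IH' addr0.
  by rewrite kdiffE raddfB /= !kaugE /mact scalerA subrr.
split=> [e0|[f <-]]; last by rewrite koszul0E raddfD /= !aug_diff addr0.
(* Modulo the image of [koszul0], the element r (x) m equals 1 (x) r m. *)
suff [f ->] : exists f, e = koszul0 f + tensor 1 (kaug e : N).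
  by exists f; rewrite e0 tensor0r addr0.
elim/induced_ind: e {e0} => [e e' [f IH] [f' IH']|r].
  by exists (f + f'); rewrite !raddfD /= {1}IH {1}IH' addrACA.
elim/jordan_ind: r => [|c r IH|r s IH IH'|r IH|r IH] m.
- by exists 0; rewrite raddf0 add0r kaugE scale1r.
- by rewrite tensorZ; apply: IH.
- have [f fE] := IH m; have [f' fE'] := IH' m; exists (f + f').
  by rewrite tensorDl {1}fE {1}fE' !raddfD /= addrACA.
- have [f fE] := IH (mact x m); exists (kin1 (tensor r m) + kin2 0 + f).
  rewrite koszul0D k0in raddf0 addr0 kdiffE -addrA.
  move: fE; rewrite !kaugE /mact scalerA => <-.
  by rewrite subrK.
have [f fE] := IH (mact y m); exists (kin1 0 + kin2 (tensor r m) + f).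
rewrite koszul0D k0in raddf0 add0r kdiffE -addrA.
move: fE; rewrite !kaugE /mact scalerA => <-.
by rewrite subrK.
Qed.

Lemma kaug_surj (m : M) : exists e, kaug e = m.
Proof. by exists (tensor 1 (m : N)); rewrite kaugE scale1r. Qed.

End InducedKoszul.

Section KoszulResolution.
Variables (K : fieldType) (M : lmodType (jordan K)).
Local Notation R := (jordan K).

Definition kspace (i : nat) : lmodType K :=
  match i with
  | 0 | 2 => restrict M
  | 1 => (restrict M * restrict M)%type
  | _ => 'rV[K]_0
  end.

Definition kmod (i : nat) : lmodType R := induced (kspace i).

Lemma kmod_eq0 i (e : kmod i.+3) : e = 0.
Proof. by apply: induced_eq => k; rewrite [LHS]thinmx0 [RHS]thinmx0. Qed.

Definition kdiffs (i : nat) : {linear kmod i.+1 -> kmod i} :=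
  match i return {linear kmod i.+1 -> kmod i} with
  | 0 => koszul0 M
  | 1 => koszul1 M
  | _ => \0
  end.

Fact kdiffs_exact i (c : kmod i.+1) : kdiffs i c = 0 <-> exists c', kdiffs i.+1 c' = c.
Proof.
case: i c => [|[|i]] c; first exact: koszul0_exact.
  by split=> [/koszul1_exact c0|[c' <-]]; [exists 0; rewrite c0 raddf0 | apply: raddf0].
by split=> [_|//]; exists 0; rewrite (kmod_eq0 c).
Qed.

Definition koszul_resolution : resolution M :=
  @Resolution R M kmod kdiffs (kaug M) (fun i => @induced_projective K (kspace i))
    (@kaug_surj K M) (@kaug_exact K M) kdiffs_exact.

End KoszulResolution.

(** * Global dimension *)

Section ProjectiveLifting.
Variables (R : nzRingType) (A B C P : lmodType R).
Variables (d : {linear A -> B}) (e : {linear B -> C}) (f : {linear P -> B}).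

Definition kernel_pred : {pred B} := fun b => e b == 0.

Fact kernel_submod : submod_closed kernel_pred.
Proof.
split=> [|a u v]; rewrite !unfold_in ?raddf0 //.
by rewrite linearP => /eqP -> /eqP ->; rewrite scaler0 addr0.
Qed.

HB.instance Definition _ := GRing.isSubmodClosed.Build R B kernel_pred kernel_submod.

Record kernel : predArgType := Kernel { kernel_val : B; _ : kernel_val \in kernel_pred }.

HB.instance Definition _ := [isSub for kernel_val].
HB.instance Definition _ := [Choice of kernel by <:].
HB.instance Definition _ := [SubChoice_isSubLmodule of kernel by <:].

(** [projective] speaks of surjections onto a module, so f and d are first corestricted to the
    kernel of e, onto which d is surjective by exactness. *)
Lemma projective_lift :
    projective P -> (forall a, e (d a) = 0) ->
    (forall b, e b = 0 -> exists a, d a = b) -> (forall u, e (f u) = 0) ->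
  exists g : {linear P -> A}, forall u, d (g u) = f u.
Proof.
move=> Pproj de ex ef.
have d_in a : d a \in kernel_pred by rewrite unfold_in de.
have f_in u : f u \in kernel_pred by rewrite unfold_in ef.
pose d' a := Kernel (d_in a); pose f' u := Kernel (f_in u).
have d'_lin : linear d' by move=> c u v; apply: val_inj; rewrite /= linearP.
have f'_lin : linear f' by move=> c u v; apply: val_inj; rewrite /= linearP.
pose dl := GRing.isLinear.Build R A kernel *:%R d' d'_lin.
pose fl := GRing.isLinear.Build R P kernel *:%R f' f'_lin.
pose dL : {linear A -> kernel} := HB.pack d' dl.
pose fL : {linear P -> kernel} := HB.pack f' fl.
have [|g gE] := Pproj A kernel dL fL.
  case=> b b_in; have [|a da] := ex b; first exact/eqP.
  by exists a; apply: val_inj.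
by exists g => u; have := congr1 val (gE u).
Qed.

End ProjectiveLifting.

(** * The trivial module and the lower bound for the global dimension *)

Section TrivialModule.
Variable K : fieldType.
Local Notation R := (jordan K).
Local Notation x := (jx K).
Local Notation y := (jy K).
Local Notation T := (trivial_module (jeps K) : lmodType R).
Local Notation N := (restrict T).
Local Notation E := (induced N).
Local Notation F := (induced (N * N)%type).

Definition tone : N := (1 : K).

Lemma mact_triv a (t : N) : mact a t = jeps K a * (t : K) :> K.
Proof. by []. Qed.

Lemma mactx (t : N) : mact x t = 0.
Proof. by rewrite [LHS]mact_triv jeps_x mul0r. Qed.

Lemma macty (t : N) : mact y t = 0.
Proof. by rewrite [LHS]mact_triv jeps_y mul0r. Qed.

Lemma koszul0_triv r p : koszul0 T (tensor r p) = tensor (r * x) p.1 + tensor (r * y) p.2.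
Proof.
by rewrite koszul0_tensor mactx macty (tensor0r _ r) !subr0.
Qed.

Lemma koszul1_triv r (t : N) : koszul1 T (tensor r t) =
  tensor (r * x) (in2 t) - tensor (r * (y + x)) (in1 t).
Proof.
rewrite koszul1_tensor mactx macty (raddf0 (@in1 K T)) (raddf0 (@in2 K T)).
by rewrite (tensor0r _ r) !subr0 addr0 mulrDr tensorDl.
Qed.

Lemma kaug_tone : kaug T (tensor 1 tone) != 0.
Proof. by rewrite kaugE scale1r; exact: oner_neq0. Qed.

Lemma kaug_scale r e : jeps K r = 0 -> kaug T (r *: e) = 0.
Proof.
move=> r0; rewrite linearZ /=.
have -> : r *: (kaug T e : T) = jeps K r * (kaug T e : K) :> K by [].
by rewrite r0 mul0r.
Qed.

(* Comparing a resolution with P_2 = 0 to the Koszul resolution gives h1 with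
   h1 (koszul1 c) = - c for the generator c, while koszul1 c has coefficients in
   the augmentation ideal: apply kaug *)
Lemma jordan_pdim_trivial e : proj_dim_le T e -> (2 <= e)%N.
Proof.
case=> r r0; rewrite leqNgt; apply/negP => e2.
have P2 (u : res_mod r 2) : u = 0 by apply: r0.
have dP_inj u : res_d r 0 u = 0 -> u = 0.
  by move=> /res_exact [v <-]; rewrite (P2 v) raddf0.
have augdP u : res_aug r (res_d r 0 u) = 0 by apply/res_exact0; exists u.
have ker_augP u : res_aug r u = 0 -> exists v, res_d r 0 v = u by move=> /res_exact0.
have aug0 c : kaug T (koszul0 T c) = 0 by apply/kaug_exact; exists c.
have ker_aug u : kaug T u = 0 -> exists v, koszul0 T v = u by move=> /kaug_exact.
have d01 c : koszul0 T (koszul1 T c) = 0 by apply/koszul0_exact; exists c.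
have ker_d0 u : koszul0 T u = 0 -> exists v, koszul1 T v = u by move=> /koszul0_exact.
(* The maps a0, a1 compare the Koszul resolution with r over the identity of T, and b0, b1 go back;
   h0, h1 begin a homotopy from their composite to the identity. *)
have [a0 a0E] := @induced_projective _ _ _ _ (res_aug r) (kaug T) (res_aug_surj r).
have [|a1 a1E] := @projective_lift _ _ _ _ _ (res_d r 0) (res_aug r) (a0 \o koszul0 T)
  (@induced_projective _ _) augdP ker_augP.
  by move=> u; rewrite /= a0E aug0.
have a1d1 c : a1 (koszul1 T c) = 0 by apply: dP_inj; rewrite a1E /= d01 raddf0.
have [b0 b0E] := @res_projective _ _ r 0 _ _ (kaug T) (res_aug r) (@kaug_surj K T).
have [|b1 b1E] := @projective_lift _ _ _ _ _ (koszul0 T) (kaug T) (b0 \o res_d r 0)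
  (@res_projective _ _ r 1) aug0 ker_aug.
  by move=> u; rewrite /= b0E augdP.
have [|h0 h0E] := @projective_lift _ _ _ _ _ (koszul0 T) (kaug T) ((b0 \o a0) \- idfun)
  (@induced_projective _ _) aug0 ker_aug.
  by move=> u; rewrite [X in kaug T X]/= raddfB /= b0E a0E subrr.
have [|h1 h1E] := @projective_lift _ _ _ _ _ (koszul1 T) (koszul0 T)
  (((b1 \o a1) \- idfun) \- (h0 \o koszul0 T)) (@induced_projective _ _) d01 ker_d0.
  move=> u; have k0B (v w : F) : koszul0 T (v - w) = koszul0 T v - koszul0 T w by apply: raddfB.
  rewrite [X in koszul0 T X]/= !k0B b1E h0E.
  by rewrite /= a1E /= subrr.
pose c := tensor 1 tone : E.
(* The homotopy identity at [koszul1] c loses two terms, as a1 kills [koszul1] c and [koszul0] does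
   too; then [koszul1] is injective. *)
have h1d1 : h1 (koszul1 T c) = - c.
  apply/eqP; rewrite -addr_eq0; apply/eqP; apply: koszul1_exact.
  rewrite raddfD /= h1E [X in X + _]/= a1d1 d01 !raddf0 sub0r addr0.
  exact: addNr.
have tensor_scale a (p : N * N) : tensor a p = a *: (tensor 1 p : F).
  by rewrite scale_tensor mulr1.
have h1Z a (p : F) : h1 (a *: p) = a *: h1 p by apply: linearZ.
(* On the generator, [koszul1] has coefficients x and y + x; by linearity so has its image under h1,
   which [kaug] therefore kills. *)
case/eqP: kaug_tone; apply: oppr_inj; rewrite oppr0 -raddfN -/c -h1d1 koszul1_triv !mul1r.
rewrite (tensor_scale x) (tensor_scale (y + x)) (raddfB h1) /= (raddfB (kaug T)) /= !h1Z.
rewrite !kaug_scale ?subrr ?jeps_x //.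
by rewrite raddfD /= jeps_x jeps_y addr0.
Qed.

Lemma jordan_global_dim : global_dim R 2.
Proof.
split=> [M|e]; last by move/(_ T)/jordan_pdim_trivial.
exists (koszul_resolution M) => -[|[|[|i]]] // _ c; exact: kmod_eq0.
Qed.

End TrivialModule.

(** * The Gorenstein property *)

Section Gorenstein.
Variable K : fieldType.
Local Notation R := (jordan K).
Local Notation x := (jx K).
Local Notation y := (jy K).
Local Notation T := (trivial_module (jeps K) : lmodType R).
Local Notation N := (restrict T).
Local Notation b k := (y ^+ k.1 * x ^+ k.2).

(** A uniform form of [regular_part], in which degree shifts in [int] are handled without separating
    the signs. *)
Definition rpart (n : int) (r : R) : Prop :=
  forall k, jcoef r k != 0 -> (k.1 + k.2)%N%:Z = n.

Lemma rpart_nat n r : rpart n%:Z r <-> jpart n r.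
Proof. by split=> h k /h => [[]|->]. Qed.

Lemma rpart_regular n (r : R^o) : regular_part (A := jordan_graded K) n r <-> rpart n r.
Proof.
case: n => n; first by split=> /rpart_nat.
split=> [->|h] /=; first by move=> k; rewrite -(scale0r (1 : R)) jcoefZ mul0r eqxx.
apply: jcoef_inj => k; rewrite -(scale0r (1 : R)) jcoefZ mul0r; apply/eqP/negP => /negP.
by move/h.
Qed.

Lemma rpart_cases n r : rpart n r -> r = 0 \/ exists2 m : nat, n = m%:Z & jpart m r.
Proof.
by case: n => [n /rpart_nat|n /(rpart_regular (Negz n))]; [right; exists n | left].
Qed.

Lemma rpart0 n : rpart n 0.
Proof. by move=> k; rewrite -(scale0r (1 : R)) jcoefZ mul0r eqxx. Qed.

Lemma rpartD n r s : rpart n r -> rpart n s -> rpart n (r + s).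
Proof.
move=> hr hs k; rewrite jcoefD; have [->|/hr//] := eqVneq (jcoef r k) 0.
by rewrite add0r; apply: hs.
Qed.

Lemma rpartZ n c r : rpart n r -> rpart n (c *: r).
Proof. by move=> h k; rewrite jcoefZ mulf_eq0 negb_or => /andP[_ /h]. Qed.

Lemma rpartM m n r s : jpart m r -> rpart n s -> rpart (m%:Z + n) (r * s).
Proof.
move=> hr /rpart_cases[->|[l -> hs]]; first by rewrite mulr0; apply: rpart0.
by rewrite -PoszD; apply/rpart_nat/jpartM.
Qed.

(** Ensures that the preimage found by exactness of the dual complex is homogeneous, as a graded
    coboundary requires. *)
Lemma rpart_divx n r : rpart (n + 1) (x * r) -> rpart n r.
Proof.
move=> h; have h1 : rpart n (jshift 1 r).
  move=> [j i] nz; have := h (j, i.+1); rewrite jx_normal jcoef_mulx /= => /(_ nz).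
  by rewrite addnS -addn1 PoszD => /addIr.
rewrite -(jshiftK 1 r); case: (rpart_cases h1) => [->|[m -> hm]].
  by rewrite raddf0; apply: rpart0.
exact/rpart_nat/jshift_part.
Qed.

Lemma rpart_split n r : n != 0 -> rpart n r ->
  exists u v, [/\ rpart (n - 1) u, rpart (n - 1) v & r = x * u + y * v].
Proof.
move=> n0 /rpart_cases[->|[m nm hr]].
  by exists 0, 0; rewrite !mulr0 addr0; split=> //; apply: rpart0.
case: m nm hr => [n_eq0|m ->]; first by rewrite n_eq0 in n0.
case/jordan_split => [u [v [hu hv ->]]]; exists u, v.
have -> : m.+1%:Z - 1 = m%:Z by rewrite -addn1 PoszD addrK.
by split=> //; apply/rpart_nat.
Qed.

Section InducedGrading.
Variables (V : lmodType K) (d : nat).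
Local Notation E := (induced V).

(** The grading of R (x) V with V placed in degree d. In the Koszul resolution d is the homological
    degree: the resolution is linear. *)
Definition ipart (n : int) (e : E) : Prop :=
  forall k, (e : {malg V[(nat * nat)%type]})@_k != 0 -> (k.1 + k.2 + d)%N%:Z = n.

Lemma ipart_is_grading : is_grading ipart.
Proof.
exact: (@is_grading_coords _ {malg V[(nat * nat)%type]} _ _
  (fun k : nat * nat => (k.1 + k.2 + d)%N%:Z) idfun id).
Qed.

Lemma ipart0 n : ipart n 0.
Proof. by move=> k; rewrite mcoeff0 eqxx. Qed.

Lemma ipartD n e e' : ipart n e -> ipart n e' -> ipart n (e + e').
Proof.
move=> h h' k; rewrite mcoeffD.
have [->|/h//] := eqVneq ((e : {malg V[(nat * nat)%type]})@_k) 0.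
by rewrite add0r; apply: h'.
Qed.

Lemma ipartN n e : ipart n e -> ipart n (- e).
Proof. by move=> h k; rewrite mcoeffN oppr_eq0; apply: h. Qed.

Lemma ipart_tensor n r v : jpart n r -> ipart (n + d)%N%:Z (tensor r v).
Proof.
move=> hr k; rewrite mcoeff_tensor => nz; rewrite (hr k) //.
by apply: contraNneq nz => ->; rewrite scale0r.
Qed.

Lemma ipart_ind n (P : E -> Prop) :
    P 0 -> (forall e e', P e -> P e' -> P (e + e')) ->
    (forall k v, (k.1 + k.2 + d)%N%:Z = n -> P (tensor (b k) v)) ->
  forall e, ipart n e -> P e.
Proof.
move=> P0 PD Pt e he; rewrite (monalgE (e : {malg V[(nat * nat)%type]})) big_seq.
apply: (big_ind P) => // k; rewrite -mcoeff_neq0 => /he kn.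
by rewrite -tensor_basis; apply: Pt.
Qed.

Lemma ipart_module : is_module_grading (A := jordan_graded K) (V := E) ipart.
Proof.
split; first exact: ipart_is_grading.
move=> m n a e am; move: e; apply: ipart_ind => [|e e' h h'|k v <-].
- by rewrite scaler0; apply: ipart0.
- by rewrite scalerDr; apply: ipartD.
rewrite scale_tensor -PoszD addnA; apply: ipart_tensor; apply: jpartM => //.
exact: jpart_basis.
Qed.

Lemma graded_map_regular l (f : {linear E -> R^o}) :
  graded_map ipart (@regular_part K (jordan_graded K)) l f <->
  forall v, rpart (d%:Z + l) (f (tensor 1 v)).
Proof.
split=> [hf v|hf n e].
  apply/rpart_regular; apply: hf; rewrite -[d]add0n; apply: ipart_tensor.
  exact: jpart1.
move: e; apply: ipart_ind => [|e e' h h'|k v <-].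
- by rewrite raddf0; apply/rpart_regular/rpart0.
- rewrite raddfD; apply/rpart_regular; apply: rpartD; exact/rpart_regular.
apply/rpart_regular; rewrite -[b k]mulr1 -scale_tensor linearZ PoszD -addrA.
by apply: rpartM => //; apply: jpart_basis.
Qed.

End InducedGrading.

Definition kpart (i : nat) : int -> kmod T i -> Prop := ipart (V := kspace T i) i.

Lemma koszul_graded : graded_resolution (A := jordan_graded K)
  (@trivial_part K R (jeps K)) (r := koszul_resolution T) kpart.
Proof.
have bpart k : jpart (k.1 + k.2) (b k) := @jpart_basis K k.1 k.2.
split=> [i|i|n e].
- exact: ipart_module.
- move=> n e; rewrite addr0; move: e; apply: ipart_ind => [|e e' h h'|k v <-].
  + by rewrite raddf0; apply: ipart0.
  + by rewrite raddfD; apply: ipartD.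
  case: i v => [|[|i]] v /=.
  + rewrite [koszul0 _ _]koszul0_triv.
    have -> : (k.1 + k.2 + 1 = (k.1 + k.2).+1 + 0)%N by rewrite addn0 addn1.
    apply: ipartD; apply: ipart_tensor; first exact/jpart_mulx.
    exact/jpart_muly.
  + rewrite [koszul1 _ _]koszul1_triv addnS -addSn.
    apply: ipartD; first by apply: ipart_tensor; apply/jpart_mulx.
    apply/ipartN/ipart_tensor; rewrite mulrDr; apply: jpartD; first exact/jpart_muly.
    exact/jpart_mulx.
  exact: ipart0.
rewrite addr0; have [->|n0] := eqVneq n 0; first by left.
move=> he; right; move: e he; apply: ipart_ind => [|e e' h h'|k v kn].
- exact: raddf0.
- by rewrite raddfD /= h h' addr0.
have k0 : jeps K (b k) = 0.
  apply: jeps_part (bpart k); rewrite lt0n; apply: contraNneq n0 => k0.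
  by rewrite -kn k0.
by rewrite -[b k]mulr1 -scale_tensor; apply: kaug_scale.
Qed.

Local Notation Rreg := (@regular_part K (jordan_graded K)).
Local Notation kcocycle i l := (@cocycle K (jordan_graded K) T R^o Rreg (koszul_resolution T) kpart i l).
Local Notation kcoboundary i l :=
  (@coboundary K (jordan_graded K) T R^o Rreg (koszul_resolution T) kpart i l).
Local Notation kcohomology i l V :=
  (@cohomology_iso K (jordan_graded K) T R^o Rreg (koszul_resolution T) kpart i l V).

Lemma koszul_cohomology0 i l (V : lmodType K) : (forall v : V, v = 0) ->
  (forall f, kcocycle i l f -> kcoboundary i l f) -> kcohomology i l V.
Proof.
move=> V0 cob; exists (fun=> 0); split=> [c f g h _ _ _ _|v|f /cob //].
  by rewrite scaler0 addr0.
exists \0; split; last by rewrite [RHS]V0.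
split=> // n e _; exact/rpart_regular/rpart0.
Qed.

Lemma regular_scale (r s : R) : r *: (s : R^o) = r * s. Proof. by []. Qed.

Lemma hom_scale (V : lmodType K) (f : {linear induced V -> R^o}) r v :
  f (tensor r v) = r * (f (tensor 1 v) : R).
Proof. by rewrite -regular_scale -linearZ scale_tensor mulr1. Qed.

Lemma hom_scaleK (V : lmodType K) (f : {linear induced V -> R^o}) (c : K) v :
  f (tensor 1 (c *: v)) = c *: (f (tensor 1 v) : R).
Proof. by rewrite -tensorZ hom_scale mulr_algl. Qed.

(** For s the value of f at 1 (x) t, the cocycle condition at (t, 0) reads x s = 0, and left
    multiplication by x is injective. *)
Lemma cocycle0 l f : kcocycle 0 l f -> forall e, f e = 0.
Proof.
case=> _ fd; apply: (@induced_lin_ext _ _ _ f \0) => t /=.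
apply: jordan_mulxI; rewrite mulr0 -hom_scale.
have := fd (tensor 1 (t, 0)); rewrite /= [koszul0 _ _]koszul0_triv /= !mul1r.
by rewrite (tensor0r _ y) addr0.
Qed.

Lemma triv_scale (c : K) (t : N) : c *: t = c * (t : K) :> K.
Proof. by rewrite -{2}[c]jeps_scalar. Qed.

Lemma tone_scaleE (t : N) : (t : K) *: tone K = t.
Proof. by rewrite [LHS]triv_scale; exact: mulr1. Qed.

Fact free_hom_klin (s : R) : klin (fun t : N => (((t : K) *: s : R) : R^o)).
Proof.
move=> c u v; transitivity ((c * (u : K) + (v : K)) *: s).
  by congr (_ *: s); congr (_ + _); rewrite [LHS]triv_scale.
by rewrite scalerDl -scalerA regular_scale mulr_algl.
Qed.

Definition free_hom (s : R) : {linear induced N -> R^o} := klift (free_hom_klin s).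

Lemma free_homE s t : free_hom s (tensor 1 t) = (t : K) *: s.
Proof. by rewrite kliftE scale1r. Qed.

Fact free_hom2_klin (s s' : R) :
  klin (fun p : N * N => (((p.1 : K) *: s + (p.2 : K) *: s' : R) : R^o)).
Proof.
move=> c u v; have := free_hom_klin s c u.1 v.1; have := free_hom_klin s' c u.2 v.2.
move=> /= e2 e1; rewrite [LHS](congr2 +%R e1 e2) addrACA.
by rewrite scalerDr.
Qed.

Definition free_hom2 (s s' : R) : {linear induced (N * N)%type -> R^o} :=
  klift (free_hom2_klin s s').

Lemma free_hom2E s s' p :
  free_hom2 s s' (tensor 1 p) = (p.1 : K) *: s + (p.2 : K) *: s'.
Proof. by rewrite kliftE scale1r. Qed.

Lemma free_hom2_in1 s s' t : free_hom2 s s' (tensor 1 (in1 t)) = (t : K) *: s.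
Proof.
rewrite free_hom2E -[RHS]addr0; congr (_ + _) => //; exact: (@scale0r K R).
Qed.

Lemma free_hom2_in2 s s' t : free_hom2 s s' (tensor 1 (in2 t)) = (t : K) *: s'.
Proof.
rewrite free_hom2E -[RHS]add0r; congr (_ + _) => //; exact: (@scale0r K R).
Qed.

Lemma hom_tone (f : {linear induced N -> R^o}) t :
  f (tensor 1 t) = (t : K) *: (f (tensor 1 (tone K)) : R).
Proof. by rewrite -hom_scaleK tone_scaleE. Qed.

Lemma hom_pair (f : {linear induced (N * N)%type -> R^o}) p :
  f (tensor 1 p) = f (tensor 1 (in1 p.1)) + f (tensor 1 (in2 p.2)).
Proof.
rewrite -raddfD -tensorDr; congr (f (tensor 1 _)).
by case: p => t t'; congr pair; rewrite /= ?addr0 ?add0r.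
Qed.

Lemma hom_in1 (f : {linear induced (N * N)%type -> R^o}) t :
  f (tensor 1 (in1 t)) = (t : K) *: (f (tensor 1 (in1 (tone K))) : R).
Proof. by rewrite -hom_scaleK -linearZ tone_scaleE. Qed.

Lemma hom_in2 (f : {linear induced (N * N)%type -> R^o}) t :
  f (tensor 1 (in2 t)) = (t : K) *: (f (tensor 1 (in2 (tone K))) : R).
Proof. by rewrite -hom_scaleK -linearZ tone_scaleE. Qed.

(** A cochain is the pair (u, v) of its values on the two generators, and the cocycle condition is
    the equation solved by [jordan_dual_exact]. *)
Lemma cocycle1 l f : kcocycle 1 l f -> kcoboundary 1 l f.
Proof.
case=> /graded_map_regular fl fd.
pose u : R := f (tensor 1 (in1 (tone K))); pose v : R := f (tensor 1 (in2 (tone K))).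
have uv : x * v = (y + x) * u.
  have := fd (tensor 1 (tone K)); rewrite /= [koszul1 _ _]koszul1_triv !mul1r raddfB /=.
  by rewrite hom_scale (hom_scale f (y + x)) => /eqP; rewrite subr_eq0 => /eqP.
have [r [ur vr]] := jordan_dual_exact uv.
exists (free_hom r); split.
  apply/graded_map_regular => t; rewrite free_homE add0r; apply: rpartZ.
  by apply: rpart_divx; rewrite -ur addrC; apply: fl.
apply: (@induced_lin_ext _ _ _ f (free_hom r \o koszul0 T)) => p /=.
rewrite koszul0_triv !mul1r raddfD /= (hom_scale _ x) (hom_scale _ y) !free_homE.
by rewrite hom_pair hom_in1 hom_in2 -/u -/v ur vr -!scalerAr.
Qed.

Lemma coboundary2 l (f : {linear induced N -> R^o}) (u v : R) :
    rpart (1 + l) u -> rpart (1 + l) v ->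
    f (tensor 1 (tone K)) = x * u + y * v ->
  kcoboundary 2 l f.
Proof.
(* A cochain with values s, s' on the generators has coboundary x s' - (y + x) s; these values solve
   x s' - (y + x) s = x u + y v. *)
move=> hu hv fuv; exists (free_hom2 (- v) (u - v)); split.
  apply/graded_map_regular => p; rewrite free_hom2E.
  have hNv : rpart (1 + l) (- v) by rewrite -scaleN1r; apply: rpartZ.
  by apply: rpartD; apply: rpartZ => //; apply: rpartD.
apply: (@induced_lin_ext _ _ _ f (free_hom2 (- v) (u - v) \o koszul1 T)) => t /=.
rewrite koszul1_triv !mul1r raddfB /= (hom_scale _ x) (hom_scale _ (y + x)).
rewrite free_hom2_in1 free_hom2_in2 hom_tone fuv.
transitivity ((t : K) *: (x * (u - v) - (y + x) * - v)); last by rewrite scalerBr !scalerAr.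
by rewrite mulrN opprK mulrBr mulrDl addrACA addNr addr0.
Qed.

(** A 2-cocycle of degree l is an element of R of degree l + 2, and coboundaries have values in x R
    + y R. All of R in nonzero degree is of that form, so only l = -2 contributes; there the
    augmentation identifies the degree-0 part with K. *)
Lemma cohomology2 l : kcohomology 2 l 'rV[K]_(l == - 2%:Z).
Proof.
have [->|l2] := eqVneq l (- 2%:Z); last first.
  apply: koszul_cohomology0 => [v|f [/graded_map_regular fl _]]; first exact: thinmx0.
  have l2' : 2%:Z + l != 0 by rewrite addrC addr_eq0.
  have [u [v [hu hv fuv]]] := rpart_split l2' (fl (tone K)).
  have l1 : 2%:Z + l - 1 = 1 + l by rewrite addrAC.
  by apply: (coboundary2 (u := u) (v := v)); rewrite -?l1.
exists (fun f => const_mx (jeps K (f (tensor 1 (tone K)) : R))); split.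
- move=> c f g h _ _ _ hE; apply/matrixP => i j; rewrite !mxE hE.
  by rewrite raddfD /= regular_scale mulr_algl jepsZ.
- move=> v; pose c := v ord0 ord0; exists (free_hom (c%:A)); split.
    split; last by move=> e; rewrite /= raddf0.
    apply/graded_map_regular => t; rewrite free_homE subrr; apply: rpartZ; apply: rpartZ.
    exact/(rpart_nat 0)/jpart1.
  rewrite free_homE scale1r jeps_scalar; apply/matrixP => i j.
  by rewrite !mxE /c !ord1.
move=> f [/graded_map_regular fl _]; split=> [/matrixP /(_ ord0 ord0)|].
  rewrite !mxE => f0; have fone : f (tensor 1 (tone K)) = 0 :> R.
    have /(rpart_nat 0)/jpart0_scalar -> : rpart 0 (f (tensor 1 (tone K))).
      by have := fl (tone K); rewrite subrr.
    by rewrite f0 scale0r.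
  apply: (coboundary2 (u := 0) (v := 0)); try exact: rpart0.
  by rewrite fone !mulr0 addr0.
case=> g [_ fg]; apply/matrixP => i j; rewrite !mxE fg /= [koszul1 _ _]koszul1_triv !mul1r.
rewrite raddfB /= (hom_scale _ x) (hom_scale _ (y + x)) raddfB /= !rmorphM rmorphD /=.
by rewrite jeps_x jeps_y addr0 !mul0r subrr.
Qed.

Lemma jordan_gorenstein : gorenstein (jordan_graded K) 2.
Proof.
exists (jeps K); split; first exact: jordan_augmentation.
exists (- 2%:Z) => i l; exists (koszul_resolution T), kpart; split.
  exact: koszul_graded.
case: i => [|[|[|i]]].
- apply: koszul_cohomology0 => [v|f /cocycle0 //]; exact: thinmx0.
- apply: koszul_cohomology0 => [v|f /cocycle1 //]; exact: thinmx0.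
- exact: cohomology2.
apply: koszul_cohomology0 => [v|f [_ fd]]; first exact: thinmx0.
exists \0; split=> [n e _|e]; first exact/rpart_regular/rpart0.
by rewrite (kmod_eq0 e) raddf0.
Qed.

Lemma jordan_regular : regular_algebra (jordan_graded K) 2.
Proof.
split.
- exact: jordan_connected.
- split; first exact: jordan_generated.
  by exists 2%N; apply: jpart_dim.
- exact: jordan_global_dim.
- exact: jordan_growth.
exact: jordan_gorenstein.
Qed.

End Gorenstein.

(** * Ore extension of the Jordan plane *)

(** The right side of the third relation in the form phi(y) z + delta(y), for u = x, v = y and w =
    z. *)
Lemma ore_relator3E (C : nzRingType) (u v w : C) :
  v * w - v ^+ 2 *+ 3 - (u * w) *+ 2 - (u * v) *+ 2 =
  (v - u *+ 2) * w + (- (v ^+ 2 *+ 3) - (u * v) *+ 2).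
Proof.
by rewrite mulrBl mulrnAl [RHS]addrA [X in X - _ = _]addrAC.
Qed.

Section OreRelators.
Variables (F C : nzRingType) (f : {rmorphism F -> C}) (u v w : F).

Lemma rmorph_relator1 :
  f (u * v - (v * u + u ^+ 2)) = f u * f v - (f v * f u + f u ^+ 2).
Proof. by rewrite !(rmorphB, rmorphD, rmorphM, rmorphXn). Qed.

Lemma rmorph_relator2 :
  f (w * u - (u * w + u ^+ 2 + v ^+ 2 *+ 3)) =
  f w * f u - (f u * f w + f u ^+ 2 + f v ^+ 2 *+ 3).
Proof. by rewrite !(rmorphB, rmorphD, rmorphM, rmorphXn, rmorphMn). Qed.

Lemma rmorph_relator3 :
  f (w * v - (v * w - v ^+ 2 *+ 3 - (u * w) *+ 2 - (u * v) *+ 2)) =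
  f w * f v - (f v * f w - f v ^+ 2 *+ 3 - (f u * f w) *+ 2 - (f u * f v) *+ 2).
Proof. by rewrite !(rmorphB, rmorphD, rmorphM, rmorphXn, rmorphMn). Qed.

End OreRelators.

Lemma mem_seq3 (T : eqType) (a b c : T) :
  [/\ a \in [:: a; b; c], b \in [:: a; b; c] & c \in [:: a; b; c]].
Proof. by rewrite !inE !eqxx !orbT. Qed.

Section GradedAlgebra.
Variables (K : fieldType) (A : graded_algebra K).

Lemma gpart0 n : gpart A n 0.
Proof. by have [] := gpart_grading A. Qed.

Lemma gpartD n a b : gpart A n a -> gpart A n b -> gpart A n (a + b).
Proof.
have [_ GB _ _] := gpart_grading A; move=> ha hb.
by rewrite -[b]opprK -[- b]sub0r; apply: (GB _ _ _) => //; apply: (GB _ _ _) => //; apply: gpart0.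
Qed.

Lemma gpart_exp a n : gpart A 1 a -> gpart A n (a ^+ n).
Proof.
move=> ha; elim: n => [|n IH]; first by rewrite expr0; apply: gpart1.
by rewrite exprS -add1n; apply: gpartM.
Qed.

End GradedAlgebra.

Theorem corollary3p2 (K : closedFieldType) (char_neq2 : 2%N \notin [pchar K])
    (A : graded_algebra K) (x : 'I_3 -> A)
    (x_deg1 : forall i, gpart A 1%N (x i))
    (A_presented :
       let x1 := fgen K (@Ordinal 3 0 isT) in
       let x2 := fgen K (@Ordinal 3 1 isT) in
       let x3 := fgen K (@Ordinal 3 2 isT) in
       presented x (fun f => f \in
         [:: x1 * x2 - (x2 * x1 + x1 ^+ 2);
             x3 * x1 - (x1 * x3 + x1 ^+ 2 + x2 ^+ 2 *+ 3);
             x3 * x2 - (x2 * x3 - x2 ^+ 2 *+ 3 - (x1 * x3) *+ 2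
                        - (x1 * x2) *+ 2)])) :
  exists R : graded_algebra K,
    regular_graded_skew_clifford R /\ Ore_extension_of R A.
Proof.
exists (jordan_graded K); split.
  split; first exact: jordan_skew_clifford.
    exact: jordan_quadratic.
  by exists 2%N; apply: jordan_regular.
pose R := jordan K; pose phi : {lrmorphism R -> R} := jshift (- 2%:R).
have [delta [Hd dx dy]] := jordan_derivation_exists K.
exists phi, delta; split.
- split; first exact: Bijective (jshiftK (- 2%:R)) (jshiftNK (- 2%:R)).
  move=> n a; split; last exact: jshift_part.
  by move=> /(@jshift_part K (- - 2%:R)); rewrite jshiftK.
- split; first exact: Hd.
  have x2 : jpart 2 (jx K ^+ 2) by rewrite expr2; exact: (jpartM (@jpartx K) (@jpartx K)).
  have y2 : jpart 2 (jy K ^+ 2) by rewrite expr2; exact: (jpartM (@jparty K) (@jparty K)).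
  move=> n a; apply: jordan_derivation_part Hd _ _; rewrite ?dx ?dy.
    by apply: jpartD; first exact: x2; rewrite -scaler_nat; apply/jpartZ/y2.
  apply: jpartD; rewrite -scaleN1r -scaler_nat; do 2! apply: jpartZ; first exact: y2.
  exact: (jpartM (@jpartx K) (@jparty K)).
move: A_presented; set X1 := fgen K _; set X2 := fgen K (Ordinal _); set X3 := fgen K (Ordinal _) => /=.
set S := fun f => _; case=> Agen Arel.
pose z := x (@Ordinal 3 2 isT).
have S0 f : S f -> fhom x f = 0.
  by move=> Sf; rewrite -fevalE; apply/Arel/gen_ideal_in.
have [S1 S2 S3] : [/\ S _, S _ & S _] := mem_seq3 _ _ _.
have fx3 : fhom x X3 = z by rewrite fhom_gen.
have uv : fhom x X1 * fhom x X2 = fhom x X2 * fhom x X1 + fhom x X1 ^+ 2.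
  by apply/eqP; rewrite -subr_eq0 -rmorph_relator1; apply/eqP/S0.
have zx : z * fhom x X1 = fhom x X1 * z + fhom x X1 ^+ 2 + fhom x X2 ^+ 2 *+ 3.
  by apply/eqP; rewrite -subr_eq0 -fx3 -rmorph_relator2; apply/eqP/S0.
have zy : z * fhom x X2 = fhom x X2 * z - fhom x X2 ^+ 2 *+ 3
    - (fhom x X1 * z) *+ 2 - (fhom x X1 * fhom x X2) *+ 2.
  by apply/eqP; rewrite -subr_eq0 -fx3 -rmorph_relator3; apply/eqP/S0.
pose iota : {lrmorphism R -> A} := jhom uv.
have iota_x : iota (jx K) = fhom x X1 := jhom_x uv.
have iota_y : iota (jy K) = fhom x X2 := jhom_y uv.
have z_iota a : z * iota a = iota (phi a) * z + iota (delta a).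
  (* By the twisted Leibniz rule the commutation law passes to products, so it need only be checked
     on the generators. *)
  have step g b : z * iota g = iota (phi g) * z + iota (delta g) ->
      z * iota b = iota (phi b) * z + iota (delta b) ->
      z * iota (b * g) = iota (phi (b * g)) * z + iota (delta (b * g)).
    move=> zg zb; rewrite Hd !rmorphM rmorphD !rmorphM mulrA zb mulrDl -mulrA zg.
    by rewrite mulrDr !mulrA addrA.
  elim/jordan_ind: a => [|c a IH|a b IHa IHb|a IH|a IH].
  - by rewrite !rmorph1 (twisted_derivation1 Hd) raddf0 mulr1 mul1r addr0.
  - by rewrite !linearZ /= -scalerAr IH scalerDr scalerAl.
  - by rewrite !raddfD /= mulrDr IHa IHb mulrDl addrACA.
  - apply: step IH; rewrite dx /phi jshift_x rmorphD rmorphMn !rmorphXn /= iota_x iota_y zx.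
    by rewrite [RHS]addrA.
  apply: step IH; rewrite dy /phi jshift_y scaleNr scaler_nat !rmorphB rmorphN /=.
  by rewrite !rmorphMn rmorphXn rmorphM /= iota_x iota_y zy ore_relator3E.
(* A lift of polynomials over R to the free algebra: its value in A is [(map_poly iota p).[z]], and
   its value in the concrete Ore extension is p itself. *)
pose sec (p : {poly R}) : free_alg K 'I_3 := \sum_(k < size p) jsec X1 X2 p`_k * X3 ^+ k.
have fhom_sec (C : algType K) (y : 'I_3 -> C)
    (yuv : fhom y X1 * fhom y X2 = fhom y X2 * fhom y X1 + fhom y X1 ^+ 2) p :
    fhom y (sec p) = \sum_(k < size p) jhom yuv p`_k * fhom y X3 ^+ k.
  rewrite /sec raddf_sum; apply: eq_bigr => k _.
  by rewrite /= rmorphM rmorphXn /= fhom_jsec.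
have sec_x p : fhom x (sec p) = (map_poly iota p).[z].
  rewrite (fhom_sec _ x uv) (@horner_coef_wide _ (size p)) ?size_poly //.
  by apply: eq_bigr => k _; rewrite coef_map /= fx3.
(* The powers of z are independent over R because they are so in the concrete
   Ore extension B, which satisfies the relations of A *)
pose B := ore Hd.
pose y (i : 'I_3) : B := if val i is 0 then ore_const Hd (jx K)
  else if val i is 1 then ore_const Hd (jy K) else ore_var Hd.
have yx1 : fhom y X1 = ore_const Hd (jx K) by rewrite fhom_gen.
have yx2 : fhom y X2 = ore_const Hd (jy K) by rewrite fhom_gen.
have yx3 : fhom y X3 = ore_var Hd by rewrite fhom_gen.
have yuv : fhom y X1 * fhom y X2 = fhom y X2 * fhom y X1 + fhom y X1 ^+ 2.
  by rewrite yx1 yx2 -!rmorphM -rmorphXn -rmorphD jordan_rel.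
have y0 f : S f -> fhom y f = 0.
  rewrite /S !inE => /or3P[] /eqP ->.
  - by rewrite [LHS]rmorph_relator1 yuv subrr.
  - rewrite [LHS]rmorph_relator2 /= yx1 yx2 yx3 ore_var_const jshift_x dx.
    by rewrite rmorphD rmorphMn !rmorphXn addrA subrr.
  rewrite [LHS]rmorph_relator3 /= yx1 yx2 yx3 ore_var_const jshift_y dy.
  rewrite scaleNr scaler_nat !rmorphB rmorphN !rmorphMn rmorphXn rmorphM.
  by rewrite ore_relator3E subrr.
have jhomE : jhom yuv =1 ore_const Hd.
  by apply: jordan_hom_ext; [rewrite jhom_x yx1 | rewrite jhom_y yx2].
have sec_y p : fhom y (sec p) = p :> {poly R}.
  rewrite (fhom_sec _ y yuv) [RHS](@ore_expand _ _ phi delta Hd p); apply: eq_bigr => k _.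
  by rewrite yx3 jhomE.
(* If [sec p] vanishes in A, it lies in the ideal of relations, hence also vanishes in B, where its
   value is p. Applied to constants this gives injectivity of [iota], and applied to differences the
   uniqueness of p. *)
have ker_p p : (map_poly iota p).[z] = 0 -> p = 0.
  rewrite -sec_x -fevalE => /Arel /(fhom_gen_ideal y0).
  by rewrite sec_y.
exists iota, z; split.
- move=> a b ab; have /(congr1 (fun p : {poly R} => p`_0)) : (a - b)%:P = 0 :> {poly R}.
    by apply: ker_p; rewrite map_polyC hornerC /= raddfB /= ab subrr.
  by rewrite coefC coef0 => /eqP; rewrite subr_eq0 => /eqP.
- move=> n; apply: jpart_ind => [c a ha|a b ha hb||j i <-].
  + by rewrite linearZ; apply: gpartZ.
  + by rewrite raddfD; apply: gpartD.
  + by rewrite raddf0; apply: gpart0.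
  rewrite rmorphM !rmorphXn /= iota_x iota_y !fhom_gen.
  by apply: gpartM; apply: gpart_exp.
- exact: x_deg1.
- exact: z_iota.
(* The elements with a polynomial expression contain 1 and are stable under left multiplication by
   the generators, so they exhaust A. *)
pose Q a := exists p : {poly R}, a = (map_poly iota p).[z].
have QC b : Q (iota b) by exists b%:P; rewrite map_polyC hornerC.
have QD a b : Q a -> Q b -> Q (a + b).
  by move=> [p ->] [q ->]; exists (p + q); rewrite rmorphD hornerD.
have QX a : Q a -> Q (a * z).
  by move=> [p ->]; exists (p * 'X); rewrite rmorphM /= map_polyX hornerMX.
have QZ b a : Q a -> Q (iota b * a).
  by move=> [p ->]; exists (b *: p); rewrite map_polyZ hornerZ.
have Qz a : Q a -> Q (z * a).
  case=> p ->; elim/poly_ind: p => [|p c IH].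
    by exists 0; rewrite rmorph0 horner0 mulr0.
  (* For p 'X + c, the product z p is handled by induction and stays in [Q] after multiplication by
     z on the right; z c is reordered by [z_iota]. *)
  rewrite rmorphD rmorphM /= map_polyX map_polyC hornerMXaddC mulrDr mulrA /=.
  by apply: (QD _ _ (QX _ IH)); rewrite z_iota; apply: (QD _ _ (QX _ (QC _)) (QC _)).
have Qgen i a : Q a -> Q (x i * a).
  case: i => [[|[|[|//]]] lt_i3] Qa.
  - have -> : x (Ordinal lt_i3) = iota (jx K); last exact: QZ.
    by rewrite iota_x fhom_gen; congr x; apply/val_inj.
  - have -> : x (Ordinal lt_i3) = iota (jy K); last exact: QZ.
    by rewrite iota_y fhom_gen; congr x; apply/val_inj.
  have -> : x (Ordinal lt_i3) = z; last exact: Qz.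
  by congr x; apply/val_inj.
(* The statement ranges over all a because [free_ind] appends generators on the right, where they
   are absorbed into a. *)
have Qf f : forall a, Q a -> Q (fhom x f * a).
  elim/free_ind: f => [a|c f IH a Qa|f g IHf IHg a Qa|f i IH a Qa].
  - by rewrite rmorph1 mul1r.
  - rewrite linearZ /= -scalerAl -mulr_algl.
    have -> : c%:A = iota c%:A :> A by rewrite linearZ rmorph1.
    exact/QZ/IH.
  - by rewrite raddfD /= mulrDl; apply: QD; [apply: IHf | apply: IHg].
  by rewrite rmorphM /= fhom_gen -mulrA; apply/IH/Qgen.
move=> a; have [f <-] := Agen a.
have [p fp] : Q (fhom x f).
  by rewrite -[fhom x f]mulr1; apply: Qf; rewrite -(rmorph1 iota); exact: QC.
exists p; rewrite fevalE; split=> // q fq; apply/eqP; rewrite -subr_eq0; apply/eqP.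
by apply: ker_p; rewrite raddfB hornerD hornerN /= -fp -fq subrr.
Qed.
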